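(* Let $F$ be a non-archimedean local field with finite residue field $\mathbb{F}_q$, $q$ odd, let $d\geq 3$ and $\mathcal{B}=\mathcal{B}_d(F)$. Let $\Gamma\le PGL_d(F)$ be a cocompact lattice preserving the type function of the vertices of $\mathcal{B}$, such that $X=\Gamma\backslash\mathcal{B}$ has injectivity radius $\geq 2$; so $X$ is a simplicial complex with a type function $\tau:X(0)\to\mathbb{Z}/d\mathbb{Z}=\{1,\dots,d\}$. For each $i$ let $V_i=\tau^{-1}(i)$. Then for any choice of subsets $W_i\subseteq V_i$, $i=1,\dots,d$, \[ \left|\frac{|E(W_1,\dots,W_d)|}{|X(d-1)|}-\prod_{i=1}^d\frac{|W_i|}{|V_i|}\right|\leq \frac{2d}{q^{1/2}}, \] where $X(d-1)$ is the set of $(d-1)$-dimensional cells of $X$ and $E(W_1,\dots,W_d)$ is the set of $(d-1)$-dimensional cells with exactly one vertex in each $W_i$.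
   Context: Let $F$ have discrete valuation $\nu:F^*\to\mathbb{Z}$, ring of integers $\mathcal{O}$, uniformizer $\pi$, residue field $\mathcal{O}/\pi\mathcal{O}$ of order $q$. A lattice is a free $\mathcal{O}$-submodule of $F^d$ of rank $d$; $L\sim\lambda L$ for $\lambda\in F^*$. The Bruhat–Tits building $\mathcal{B}_d(F)$ has as vertices the classes $[L]$, and a set of distinct vertices $\{[L_1],\dots,[L_k]\}$ is a face iff after renumbering there are representatives with $\pi L_1'\subsetneq L_k'\subsetneq\dots\subsetneq L_2'\subsetneq L_1'$. $G=PGL_d(F)$ acts on it; $K=PGL_d(\mathcal{O})$ stabilizes $x_0=[\mathcal{O}^d]$. The type of the vertex $g x_0$ is $\nu(\det g)\bmod d$; every facet has one vertex of each type, and $\Gamma$ preserves the type function iff $\nu(\det\gamma)\equiv 0\bmod d$ for all $\gamma\in\Gamma$. The injectivity radius of $X=\Gamma\backslash\mathcal{B}$ is the largest $r$ such that the covering map $\mathcal{B}\to X$ is injective on every ball of radius $r$ (graph distance in the 1-skeleton). *)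

(* Defs.v *)
From HB Require Import structures.
From mathcomp Require Import all_boot all_order all_algebra.
From mathcomp Require Import finmap.
From mathcomp Require Import boolp classical_sets functions cardinality reals.
From Stdlib Require List.
Set Implicit Arguments. Unset Strict Implicit. Unset Printing Implicit Defensive.
Import Order.TTheory GRing.Theory Num.Theory.
Local Open Scope classical_set_scope.
Local Open Scope ring_scope.

(* nu : F -> int is the (normalized) discrete valuation on F^*; its    *)
(* value at 0 is irrelevant (0 is treated as having valuation +oo).    *)
Section LocalField.
Variables (F : fieldType) (nu : F -> int).

Definition vge (x : F) (n : int) : Prop := x = 0 \/ n <= nu x.

Definition intO (x : F) : Prop := vge x 0.

Definition discrete_valuation : Prop :=
  [/\ (forall x y, x != 0 -> y != 0 -> nu (x * y) = nu x + nu y),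
      (forall x y, x != 0 -> y != 0 -> x + y != 0 ->
          Num.min (nu x) (nu y) <= nu (x + y))
    & (forall n : int, exists x, x != 0 /\ nu x = n)].

Definition complete_valuation : Prop :=
  forall a : nat -> F,
    (forall N : nat, exists M : nat, forall m n, (M <= m)%N -> (M <= n)%N ->
        vge (a m - a n) N%:Z) ->
    exists l : F, forall N : nat, exists M : nat, forall n, (M <= n)%N ->
        vge (a n - l) N%:Z.

(* the residue field O / pi O has exactly q elements: a list of q
   representatives in O, pairwise incongruent mod the maximal ideal,
   and covering O modulo the maximal ideal *)
Definition residue_field_card (q : nat) : Prop :=
  exists s : seq F,
    [/\ size s = q,
        (forall i, (i < size s)%N -> intO (nth (0:F) s i)),
        (forall i j, (i < size s)%N -> (j < size s)%N ->
            vge (nth (0:F) s i - nth (0:F) s j) 1 -> i = j)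
      & (forall x, intO x -> exists i, (i < size s)%N /\ vge (x - nth (0:F) s i) 1)].

Definition local_field (q : nat) : Prop :=
  [/\ discrete_valuation, complete_valuation & residue_field_card q].

End LocalField.

(* Vectors are columns 'cV[F]_d, G = GL_d(F) acts on the left; a       *)
(* subgroup of PGL_d(F) is represented by its full preimage Gam in     *)
(* GL_d(F) (which contains all nonzero scalar matrices).               *)
Section Building.
Variables (F : fieldType) (nu : F -> int) (d : nat) (pi : F).
Local Notation vec := 'cV[F]_d.

Definition std_lattice : set vec := [set v | forall i, intO nu (v i 0)].

Definition lattice_of (g : 'M[F]_d) : set vec := [set g *m v | v in std_lattice].

(* a lattice = free O-submodule of F^d of rank d = g O^d with g invertible *)
Definition is_lattice (L : set vec) : Prop :=
  exists g : 'M[F]_d, g \in unitmx /\ L = lattice_of g.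

Definition scale_set (c : F) (L : set vec) : set vec := [set c *: x | x in L].

Definition act (g : 'M[F]_d) (L : set vec) : set vec := [set g *m x | x in L].

Definition same_vertex (L L' : set vec) : Prop :=
  exists c : F, c != 0 /\ L' = scale_set c L.

Definition lat_type (L : set vec) (i : 'I_d) : Prop :=
  exists g : 'M[F]_d, [/\ g \in unitmx, L = lattice_of g &
     (nu (\det g) %% d%:Z)%Z = i%:Z].

Fixpoint strict_desc (s : seq (set vec)) : Prop :=
  match s with
  | A :: ((B :: _) as t) => B `<` A /\ strict_desc t
  | _ => True
  end.

Definition face_chain (s : seq (set vec)) : Prop :=
  match s with
  | [::] => False
  | L1 :: _ => strict_desc s /\ scale_set pi L1 `<` last L1 s
  end.

(* the vertices [L] for L in s are distinct and form a face of B: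
   after renumbering there are representatives forming a face chain *)
Definition is_face (s : seq (set vec)) : Prop :=
  [/\ (forall L, List.In L s -> is_lattice L),
      (forall i j, (i < size s)%N -> (j < size s)%N ->
          same_vertex (nth set0 s i) (nth set0 s j) -> i = j)
    & exists t : seq (set vec),
        [/\ size t = size s, face_chain t,
            (forall L', List.In L' t -> exists L, List.In L s /\ same_vertex L L')
          & (forall L, List.In L s -> exists L', List.In L' t /\ same_vertex L L')]].

Definition adjacent (L L' : set vec) : Prop := is_face [:: L; L'].

Definition dist_le2 (L L' : set vec) : Prop :=
  same_vertex L L' \/ adjacent L L' \/ exists M, adjacent L M /\ adjacent M L'.

Variable Gam : set 'M[F]_d.

(* Gam is the preimage in GL_d(F) of a subgroup of PGL_d(F) *)
Definition PGL_subgroup : Prop :=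
  [/\ (forall g, Gam g -> g \in unitmx),
      (forall c : F, c != 0 -> Gam c%:M),
      (forall g h, Gam g -> Gam h -> Gam (g *m h))
    & (forall g, Gam g -> Gam (invmx g))].

(* discreteness in PGL_d(F): some congruence neighbourhood
   F^* (1 + pi^N M_d(O)) of the identity meets Gam only in scalars *)
Definition discrete_PGL : Prop :=
  exists N : nat, forall g, Gam g ->
    (exists c : F, c != 0 /\ forall i j, vge nu ((c *: g - 1%:M) i j) N%:Z) ->
    exists c : F, g = c%:M.

(* cocompactness: Gam \ PGL_d(F) / PGL_d(O) is finite, i.e. finitely many
   Gam-orbits of vertices of B *)
Definition cocompact : Prop :=
  exists s : seq (set vec), forall L, is_lattice L ->
    exists L0, [/\ List.In L0 s, is_lattice L0 & exists g, Gam g /\ L = act g L0].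

Definition cocompact_lattice : Prop := [/\ PGL_subgroup, discrete_PGL & cocompact].

Definition type_preserving : Prop :=
  forall g L i, Gam g -> is_lattice L -> lat_type L i -> lat_type (act g L) i.

(* the covering map B -> Gam \ B is injective on every ball of radius 2 *)
Definition inj_radius_ge2 : Prop :=
  forall x y z, is_lattice x -> is_lattice y -> is_lattice z ->
    dist_le2 x y -> dist_le2 x z ->
    (exists g, Gam g /\ z = act g y) -> same_vertex y z.

(* the vertex of X = Gam \ B below [L]: its Gam-orbit *)
Definition orbit (L : set vec) : set (set vec) := [set act g L | g in Gam].

Definition Xvert : set (set (set vec)) := [set orbit L | L in is_lattice].

Definition Vtype (i : 'I_d) : set (set (set vec)) :=
  [set orbit L | L in [set L | is_lattice L /\ lat_type L i]].

(* X(d-1): (d-1)-cells of the simplicial complex X, given by their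
   vertex sets (images of the chambers of B) *)
Definition Xtop : set (set (set (set vec))) :=
  [set [set orbit L | L in [set L | List.In L s]]
     | s in [set s | is_face s /\ size s = d]].

Definition Ecells (W : 'I_d -> set (set (set vec))) : set (set (set (set vec))) :=
  [set c | Xtop c /\ forall i, exists! o, c o /\ W i o].

End Building.

(* Main.v *)
Require Import Defs.
From HB Require Import structures.
From mathcomp Require Import all_boot all_order all_algebra.
From mathcomp Require Import finmap.
From mathcomp Require Import boolp classical_sets functions cardinality reals.
From mathcomp Require Import ring lra zify.
Import Order.TTheory GRing.Theory Num.Theory.
Local Open Scope classical_set_scope.
Local Open Scope ring_scope.

(* Only links enter the proof, and no representation theory. A chamber of the
   building is a chain of lattices [c k], with [c k] of degree [k] (the valuation
   of the determinant of a basis) and [c (k + d) = pi * c k]; changing one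
   lattice of the chain gives the [q + 1] chambers adjacent to it. Let [P_i]
   average functions on the chambers of [X] over the classes of [i]-adjacent
   chambers. As the injectivity radius is at least [2], residues in [X] are
   residues in the building: projective planes over the residue field for types
   [i], [i + 1] modulo [d], and products otherwise. Hence the orthogonal
   projections [P_i] satisfy the relations of the Iwahori-Hecke algebra of affine
   type A: they commute or fulfil a braid relation with parameter
   [mu = q / (q + 1)^2 <= 1 / q].

   If [2 d > sqrt q] there is nothing to prove. Otherwise the pairwise angles
   between the kernels of the [P_i] are so large that the Laplacian
   [A = sum_i (1 - P_i)] satisfies [A <= 2 A^2], whence [|h|^2 <= 2 <A h, h>] for
   [h] orthogonal to the constants (the building is gallery connected). If [f]
   has mean zero and depends on the vertex of type [i] only, then [h = P_i f] is
   fixed by [P_j] for [j <> i - 1, i + 1], and [|h - P_j h|^2 <= mu |f|^2] for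
   the other two; so [|P_i f|^2 <= 4 mu |f|^2]. Thus the indicator function of
   [W_i] has covariance at most [2 / sqrt q] with every function with values in
   [[0, 1]] of the other vertices, and a telescoping product gives the bound. *)

Set Implicit Arguments.
Unset Strict Implicit.
Unset Printing Implicit Defensive.

(** * Orthogonal projections satisfying braid relations *)

Section Dot.
Variables (R : realFieldType) (n : nat).
Implicit Types (u v w : 'rV[R]_n) (A : 'M[R]_n).

Definition dot u v : R := (u *m v^T) 0 0.

Lemma dotE u v : dot u v = \sum_i u 0 i * v 0 i.
Proof. by rewrite /dot mxE; apply: eq_bigr => i _; rewrite mxE. Qed.

Lemma dotC u v : dot u v = dot v u.
Proof. by rewrite !dotE; apply: eq_bigr => i _; rewrite mulrC. Qed.

Lemma dotDl u v w : dot (u + v) w = dot u w + dot v w.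
Proof. by rewrite /dot mulmxDl mxE. Qed.

Lemma dotZl a u v : dot (a *: u) v = a * dot u v.
Proof. by rewrite /dot -scalemxAl mxE. Qed.

Lemma dotDr u v w : dot w (u + v) = dot w u + dot w v.
Proof. by rewrite dotC dotDl !(dotC w). Qed.

Lemma dotZr a u v : dot v (a *: u) = a * dot v u.
Proof. by rewrite dotC dotZl (dotC v). Qed.

Lemma dotNl u v : dot (- u) v = - dot u v.
Proof. by rewrite -scaleN1r dotZl mulN1r. Qed.

Lemma dot0l u : dot 0 u = 0.
Proof. by rewrite -(scale0r 0) dotZl mul0r. Qed.

Lemma dot_suml (I : finType) (F : I -> 'rV[R]_n) v :
  dot (\sum_i F i) v = \sum_i dot (F i) v.
Proof. by rewrite /dot mulmx_suml summxE. Qed.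

Lemma dot_sumr (I : finType) (F : I -> 'rV[R]_n) v :
  dot v (\sum_i F i) = \sum_i dot v (F i).
Proof. by rewrite dotC dot_suml; apply: eq_bigr => i _; rewrite dotC. Qed.

Lemma dot_ge0 u : 0 <= dot u u.
Proof. by rewrite dotE sumr_ge0 // => i _; rewrite -expr2 sqr_ge0. Qed.

Lemma dot_eq0 u : dot u u = 0 -> u = 0.
Proof.
rewrite dotE => /psumr_eq0P => h; apply/rowP => i; rewrite !mxE.
by apply/eqP; have /eqP := h (fun i _ => sqr_ge0 (u 0 i)) i isT; rewrite mulf_eq0 orbb.
Qed.

Lemma dot_mulC u v A : A^T = A -> dot (u *m A) v = dot u (v *m A).
Proof. by move=> sA; rewrite /dot trmx_mul sA mulmxA. Qed.

(** The quadratic polynomial [t -> <(t u + v) A, t u + v>] is nonnegative, so its discriminant is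
    nonpositive. *)
Lemma cauchy_schwarz_form A u v : A^T = A -> (forall w, 0 <= dot (w *m A) w) ->
  dot (u *m A) v ^+ 2 <= dot (u *m A) u * dot (v *m A) v.
Proof.
move=> sA pA.
set a := dot (u *m A) u; set b := dot (u *m A) v; set c := dot (v *m A) v.
have q t : 0 <= a * t ^+ 2 + 2 * b * t + c.
  have := pA (t *: u + v).
  rewrite mulmxDl -scalemxAl !dotDl !dotDr !dotZl !dotZr -/a -/b -/c.
  by rewrite (dot_mulC v u) // (dotC v) -/b => h; have -> : a * t ^+ 2 + 2 * b * t + c = t * (t * a) + t * b + (t * b + c) by ring.
have [a0|a0] := eqVneq a 0.
  suff -> : b = 0 by rewrite a0 mul0r expr0n.
  (* With [a = 0] the polynomial is affine, and for nonzero [b] it would take the value [-1] at this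
     point. *)
  apply/eqP/negPn/negP => b0; have := q (- (c + 1) / (2 * b)).
  rewrite a0 mul0r add0r; have -> : 2 * b * (- (c + 1) / (2 * b)) + c = -1 by field; rewrite b0.
  by rewrite ler0N1.
have ap : 0 < a by rewrite lt_neqAle eq_sym a0 pA.
have := q (- b / a); have -> : a * (- b / a) ^+ 2 + 2 * b * (- b / a) + c = (a * c - b ^+ 2) / a by field.
by rewrite pmulr_lge0 ?invr_gt0 // subr_ge0.
Qed.

Lemma cauchy_schwarz u v : dot u v ^+ 2 <= dot u u * dot v v.
Proof.
have := cauchy_schwarz_form u v (trmx1 _ _); rewrite !mulmx1; apply => w.
by rewrite mulmx1 dot_ge0.
Qed.

End Dot.

Section Projections.
Variables (R : realFieldType) (n : nat).
Implicit Types (mu lam : R) (u v w : 'rV[R]_n) (P Q : 'M[R]_n).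

Definition orthoproj P := P^T = P /\ P *m P = P.

Lemma orthoproj_compl P : orthoproj P -> orthoproj (1%:M - P).
Proof.
move=> [sP iP]; split; first by rewrite linearB /= trmx1 sP.
by rewrite mulmxBl mul1mx mulmxBr mulmx1 iP subrr subr0.
Qed.

Lemma dot_proj P u v : orthoproj P -> dot (u *m P) v = dot (u *m P) (v *m P).
Proof. by move=> [sP iP]; rewrite -[RHS]dot_mulC // -mulmxA iP. Qed.

(* The braid relation of the Iwahori-Hecke algebra, written for the
   idempotents [P = (1 + T) / (q + 1)], with [mu = q / (q + 1)^2]. *)
Definition braid (mu : R) P Q := P *m Q *m P - mu *: P = Q *m P *m Q - mu *: Q.

Lemma compl_sandwich P Q : P *m P = P ->
  (1%:M - P) *m (1%:M - Q) *m (1%:M - P) =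
  1%:M - P - Q + P *m Q + Q *m P - P *m Q *m P.
Proof.
move=> iP; rewrite !mulmxBl !mulmxBr !mulmxBl !mul1mx !mulmx1 iP.
move: (P *m Q) (P *m Q *m P) (Q *m P) 1%:M => X Y Z I.
by apply/matrixP => i j; rewrite !mxE; ring.
Qed.

(** [(1 - P)(1 - Q)(1 - P) - mu (1 - P)] equals [(1 - mu) - P - Q + P Q + Q P - (P Q P - mu P)], and
    the relation makes the last bracket symmetric in [P] and [Q]. *)
Lemma braid_compl mu P Q : orthoproj P -> orthoproj Q ->
  braid mu P Q -> braid mu (1%:M - P) (1%:M - Q).
Proof.
move=> [_ iP] [_ iQ] b; rewrite /braid !compl_sandwich // -[P *m Q *m P](subrK (mu *: P)) b.
move: (P *m Q) (Q *m P) (Q *m P *m Q) 1%:M => X Y Z I.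
by apply/matrixP => i j; rewrite !mxE; ring.
Qed.

(* [braid_idem] is the projection onto the intersection of the two ranges. *)
Definition braid_idem mu P Q := (1 - mu)^-1 *: (P *m Q *m P - mu *: P).

(** [B = P Q P - mu P] is also [Q P Q - mu Q], so both [P] and [Q] fix it; hence
    [B B = (P Q P - mu P) B = (1 - mu) B]. *)
Lemma braid_idem_proj mu P Q : mu < 1 -> orthoproj P -> orthoproj Q ->
  braid mu P Q -> [/\ orthoproj (braid_idem mu P Q),
    P *m braid_idem mu P Q = braid_idem mu P Q & Q *m braid_idem mu P Q = braid_idem mu P Q].
Proof.
move=> mu1 [sP iP] [sQ iQ] b; set B := P *m Q *m P - mu *: P.
have mu0 : 1 - mu != 0 by rewrite subr_eq0 eq_sym lt_eqF.
have sB : B^T = B by rewrite /B linearB /= linearZ /= !trmx_mul sP sQ mulmxA.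
have PB : P *m B = B by rewrite /B mulmxBr -scalemxAr !mulmxA iP.
have QB : Q *m B = B.
  by rewrite [B]b mulmxBr -scalemxAr !mulmxA iQ.
have BB : B *m B = (1 - mu) *: B.
  rewrite {1}/B mulmxBl -scalemxAl -!mulmxA PB QB PB.
  by rewrite scalerBl scale1r.
split; [split| |]; rewrite /braid_idem -/B.
- by rewrite linearZ /= sB.
- rewrite -scalemxAl -scalemxAr BB scalerA scalerA; congr (_ *: _).
  by field.
- by rewrite -scalemxAr PB.
- by rewrite -scalemxAr QB.
Qed.

(** Off the common range of [P] and [Q] the relation reads [P Q P = mu P], so there the cosine of
    the angle between the ranges is at most [sqrt mu <= lam]; the common component contributes a
    nonnegative inner product. *)
Lemma dot_compl_braid_ge mu lam P Q v : 0 <= mu <= lam ^+ 2 -> mu < 1 -> 0 < lam ->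
  orthoproj P -> orthoproj Q -> braid mu P Q ->
  - lam * (dot (v *m P) (v *m P) + dot (v *m Q) (v *m Q)) <= 2 * dot (v *m P) (v *m Q).
Proof.
move=> /andP[mu0 mulam] mu1 lam0 oP oQ b.
have [oE PE QE] := braid_idem_proj mu1 oP oQ b.
set E := braid_idem mu P Q in oE PE QE.
have PQP : P *m Q *m P = mu *: P + (1 - mu) *: E.
  rewrite /E /braid_idem scalerA mulfV ?scale1r; first by rewrite addrC subrK.
  by rewrite subr_eq0 eq_sym lt_eqF.
clearbody E.
have EP : E *m P = E by rewrite -[E]oE.1 -[P]oP.1 -trmx_mul PE.
have EQ : E *m Q = E by rewrite -[E]oE.1 -[Q]oQ.1 -trmx_mul QE.
set e := v *m E; set a := v *m P - e; set c := v *m Q - e.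
have Xe X : X *m E = E -> dot (v *m X - e) e = 0.
  move=> XE; rewrite dotDl dotNl /e dotC (dot_mulC v (v *m X)); last exact: oE.1.
  by rewrite -mulmxA XE -dot_mulC ?oE.1 // dot_proj // subrr.
have [ae ce] : dot a e = 0 /\ dot c e = 0 by rewrite !Xe.
have aP : a *m P = a by rewrite mulmxBl -!mulmxA oP.2 EP.
have cQ : c *m Q = c by rewrite mulmxBl -!mulmxA oQ.2 EQ.
have aQ2 : dot (a *m Q) (a *m Q) = mu * dot a a.
  rewrite -dot_proj // -{1}aP -{2}aP -(dot_mulC _ _ oP.1) -!mulmxA (mulmxA P) PQP.
  rewrite mulmxDr -!scalemxAr aP dotDl !dotZl.
  suff -> : a *m E = 0 by rewrite dot0l mulr0 addr0.
  by rewrite mulmxBl /e -!mulmxA PE oE.2 subrr.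
have ac : dot a c = dot (a *m Q) c by rewrite -{1}cQ -dot_mulC ?oQ.1.
(* With the weight [lam] and [mu <= lam^2], both square terms are at most [lam^2] times a squared
   norm, so that one factor [lam] cancels. *)
have := dot_ge0 (a *m Q + lam *: c).
rewrite dotDl !dotDr !dotZl !dotZr aQ2 (dotC c) -ac => h.
have -> : v *m P = a + e by rewrite subrK.
have -> : v *m Q = c + e by rewrite subrK.
clearbody a c e.
rewrite !dotDl !dotDr ae ce !(dotC e) ae ce !addr0 !add0r.
have h1 : 0 <= (lam ^+ 2 - mu) * dot a a by rewrite mulr_ge0 ?subr_ge0 ?dot_ge0.
have h2 : 0 <= lam * (lam * dot a a + lam * dot c c + 2 * dot a c) by nra.
rewrite pmulr_rge0 // in h2.
have e0 := dot_ge0 e; nra.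
Qed.

End Projections.

(** * The spectral gap of a sum of complementary projections *)

Section SpectralGap.
Variables (R : realFieldType) (n d : nat) (P : 'I_d -> 'M[R]_n) (nb : rel 'I_d).
Variables (mu lam : R).
Hypotheses (oP : forall i, orthoproj (P i))
  (nbP : forall i j, i != j -> nb i j -> braid mu (P i) (P j))
  (nonnbP : forall i j, i != j -> ~~ nb i j -> P i *m P j = P j *m P i)
  (mulam : 0 <= mu <= lam ^+ 2) (mu1 : mu < 1) (lam0 : 0 < lam)
  (lamd : 2 * lam * d%:R <= 1).

Let Q i := 1%:M - P i.
Let oQ i : orthoproj (Q i). Proof. exact/orthoproj_compl/oP. Qed.

Definition laplacian := \sum_i (1%:M - P i).

Implicit Types (v h f w : 'rV[R]_n).

Let lapE v : v *m laplacian = \sum_i v *m Q i.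
Proof. by rewrite /laplacian mulmx_sumr. Qed.

Lemma laplacian_sym : laplacian^T = laplacian.
Proof. by rewrite /laplacian linear_sum; apply: eq_bigr => i _; exact: (oQ i).1. Qed.

Lemma dot_laplacian v : dot (v *m laplacian) v = \sum_i dot (v *m Q i) (v *m Q i).
Proof. by rewrite lapE dot_suml; apply: eq_bigr => i _; rewrite dot_proj. Qed.

Lemma laplacian_ge0 v : 0 <= dot (v *m laplacian) v.
Proof. by rewrite dot_laplacian sumr_ge0 // => i _; rewrite dot_ge0. Qed.

(** Expand [|v A|^2] into the products [<v Q_i, v Q_j>]. The diagonal gives [<v A, v>]; the other
    terms are nonnegative when the projections commute, and otherwise cost in total at most
    [lam d <v A, v>], half of the diagonal. *)
Lemma dot_laplacian_le v :
  dot (v *m laplacian) v <= 2 * dot (v *m laplacian) (v *m laplacian).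
Proof.
pose a i := dot (v *m Q i) (v *m Q i).
have a0 i : 0 <= a i by apply: dot_ge0.
(* One lower bound for all pairs, the diagonal included, so that the double sum can be evaluated at
   once. *)
have key i j : (i == j)%:R * a i - lam / 2 * (a i + a j) <= dot (v *m Q i) (v *m Q j).
  have [<-|ij] := eqVneq i j.
    by rewrite -/(a i) /=; have := mulr_ge0 (ltW lam0) (a0 i); lra.
  rewrite mul0r add0r; case nij: (nb i j).
    have := dot_compl_braid_ge v mulam mu1 lam0 (oQ i) (oQ j)
       (braid_compl (oP i) (oP j) (nbP ij nij)).
    by rewrite -/(a i) -/(a j); lra.
  (* The product of commuting projections is a projection, so the inner product is the squared norm
     of [v Q_i Q_j]. *)
  have QC : Q i *m Q j = Q j *m Q i.
    rewrite /Q !mulmxBl !mulmxBr !mul1mx !mulmx1 (nonnbP ij) ?nij //.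
    by rewrite !opprB addrACA [in RHS]addrACA (addrC 1%:M) // [- P i + _]addrC.
  have -> : dot (v *m Q i) (v *m Q j) = dot (v *m Q i *m Q j) (v *m Q i *m Q j).
    rewrite -(dot_mulC _ v (oQ j).1) -[RHS]dot_proj // -(dot_mulC _ v (oQ i).1).
    by rewrite -!mulmxA -QC (mulmxA (Q i)) (oQ i).2.
  by apply: le_trans (dot_ge0 _); have := mulr_ge0 (ltW lam0) (addr_ge0 (a0 i) (a0 j)); lra.
have -> : dot (v *m laplacian) (v *m laplacian) = \sum_i dot (v *m Q i) (v *m laplacian).
  by rewrite {1}lapE dot_suml.
rewrite dot_laplacian.
set S := \sum_i _; have S0 : 0 <= S by apply: sumr_ge0 => i _; exact: a0.
suff : S - lam * d%:R * S <= \sum_i dot (v *m Q i) (v *m laplacian).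
  have : 2 * lam * d%:R * S <= 1 * S by exact: ler_wpM2r.
  by move: (\sum_i _) => T; lra.
have -> : S - lam * d%:R * S = \sum_i \sum_j ((i == j)%:R * a i - lam / 2 * (a i + a j)).
  transitivity (\sum_i (a i - lam / 2 * (d%:R * a i + S))).
    rewrite sumrB -mulr_sumr big_split /= -mulr_sumr sumr_const card_ord -/S -mulr_natl.
    by field.
  apply: eq_bigr => i _; rewrite sumrB -mulr_sumr big_split /= sumr_const card_ord mulr_natl.
  congr (_ - _); rewrite (bigD1 i) //= eqxx mul1r big1 ?addr0 // => j.
  by rewrite eq_sym => /negbTE ->; rewrite mul0r.
by apply: ler_sum => i _; rewrite lapE dot_sumr; apply: ler_sum => j _.
Qed.

(** The kernel of the symmetric [A = laplacian] consists of the joint fixed vectors, so [h = u A].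
    Cauchy-Schwarz for the form of [A] gives [|h|^4 <= <u A, u> <h A, h>], and
    [<u A, u> <= 2 |u A|^2 = 2 |h|^2]. *)
Lemma laplacian_gap h : (forall w, (forall i, w *m P i = w) -> dot h w = 0) ->
  dot h h <= 2 * dot (h *m laplacian) h.
Proof.
move=> horth.
have /submxP[u hu] : (h <= laplacian)%MS.
  rewrite submxE; apply/eqP/rowP => j; rewrite [RHS]mxE.
  (* Transposed columns of the cokernel matrix are kernel vectors; the form being a sum of squares,
     every [Q i] kills them. *)
  pose w : 'rV_n := (col j (cokermx laplacian))^T.
  have wA : w *m laplacian = 0.
    apply: trmx_inj; rewrite trmx_mul laplacian_sym trmxK trmx0.
    by rewrite colE mulmxA mulmx_coker mul0mx.
  have wP i : w *m P i = w.
    have := dot_laplacian w; rewrite wA dot0l => /esym/psumr_eq0P w0.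
    have /dot_eq0 := w0 (fun i _ => dot_ge0 _) i isT.
    by rewrite /Q mulmxBr mulmx1 => /eqP; rewrite subr_eq0 => /eqP <-.
  by have := horth w wP; rewrite /dot trmxK colE mulmxA -colE mxE.
have CS := cauchy_schwarz_form u h laplacian_sym laplacian_ge0.
rewrite -hu in CS.
have hu2 : dot h u <= 2 * dot h h.
  by have := dot_laplacian_le u; rewrite -hu.
have h0 := dot_ge0 h; have hA0 := laplacian_ge0 h.
have [->|hn] := eqVneq (dot h h) 0; first by rewrite mulr_ge0.
have hp : 0 < dot h h by rewrite lt_neqAle eq_sym hn.
rewrite -(ler_pM2r hp); apply: le_trans (_ : dot h u * dot (h *m laplacian) h <= _).
  by rewrite -expr2.
by rewrite mulrAC ler_wpM2r.
Qed.

(** With [e] the component of [f] in the common range, [f P_i P_j = mu f + (1 - mu) e] on the range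
    of [P_j], and the left side equals [mu (1 - mu) (|f|^2 - |e|^2)]. *)
Lemma dot_braid_compl_le i j f : i != j -> nb i j -> f *m P j = f ->
  dot (f *m P i *m Q j) (f *m P i *m Q j) <= mu * dot f f.
Proof.
move=> ij nij fj; have b := esym (nbP ij nij).
have [oE JE IE] := braid_idem_proj mu1 (oP j) (oP i) b.
set E := braid_idem mu (P j) (P i) in oE IE JE.
have JIJ : P j *m P i *m P j = mu *: P j + (1 - mu) *: E.
  rewrite /E /braid_idem scalerA mulfV ?scale1r; first by rewrite addrC subrK.
  by rewrite subr_eq0 eq_sym lt_eqF.
clearbody E; set e := f *m E.
have e0 : 0 <= dot e e := dot_ge0 e.
have fE : dot f e = dot e e by rewrite dotC /e dot_proj.
have fJIJ : f *m P i *m P j = mu *: f + (1 - mu) *: e.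
  by rewrite -{1}fj -!mulmxA (mulmxA (P j)) JIJ mulmxDr -!scalemxAr fj.
have fi : dot (f *m P i) f = dot f (f *m P i *m P j).
  by rewrite -{2}fj -(dot_mulC _ _ (oP j).1) dotC.
rewrite -dot_proj // mulmxBr mulmx1 dotDl dotNl.
have -> : dot (f *m P i) (f *m P i) = dot (f *m P i) f by rewrite -dot_proj.
rewrite (dot_proj _ _ (oP j)) fi fJIJ !dotDl !dotDr !dotZl !dotZr (dotC e f) fE.
have /andP[m0 _] := mulam.
have ff0 := dot_ge0 f.
have : 0 <= mu ^+ 2 * dot f f by rewrite mulr_ge0 // sqr_ge0.
have : 0 <= mu * (1 - mu) * dot e e by rewrite !mulr_ge0 // subr_ge0 ltW.
nra.
Qed.

(** In the gap inequality for [f P_i] the term of [i] vanishes, and so do those of the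
    non-neighbours [j], where [P_j] commutes with [P_i] and fixes [f]. At most two terms remain,
    each at most [mu |f|^2]. *)
Lemma dot_proj_small i f : (\sum_j (nb i j)%:R <= 2 :> R) ->
  (forall j, j != i -> f *m P j = f) ->
  (forall w, (forall j, w *m P j = w) -> dot f w = 0) ->
  dot (f *m P i) (f *m P i) <= 4 * mu * dot f f.
Proof.
move=> nb2 fP forth; have /andP[m0 _] := mulam.
have gap : dot (f *m P i) (f *m P i) <= 2 * dot (f *m P i *m laplacian) (f *m P i).
  by apply: laplacian_gap => w wP; rewrite dot_mulC ?(oP i).1 // wP forth.
apply: (le_trans gap); have -> : 4 * mu * dot f f = 2 * (2 * (mu * dot f f)) by ring.
rewrite ler_pM2l // dot_laplacian.
apply: (@le_trans _ _ (\sum_j (nb i j)%:R * (mu * dot f f))); last first.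
  by rewrite -mulr_suml ler_wpM2r // mulr_ge0 // dot_ge0.
apply: ler_sum => j _; have [->|ij] := eqVneq j i.
  rewrite /Q mulmxBr mulmx1 -mulmxA (oP i).2 subrr dot0l.
  by rewrite mulr_ge0 // mulr_ge0 // dot_ge0.
case nij: (nb i j).
  by rewrite mul1r dot_braid_compl_le ?nij 1?eq_sym ?fP.
rewrite mul0r /Q mulmxBr mulmx1 -mulmxA nonnbP ?nij 1?eq_sym //.
by rewrite mulmxA (fP j) // subrr dot0l.
Qed.

End SpectralGap.

(** * Mixing in finite chamber systems *)

Section Mixing.
Variables (R : rcfType) (T : finType) (d q : nat) (adj : 'I_d -> rel T) (nb : rel 'I_d).
Hypotheses (adj_refl : forall i, reflexive (adj i))
  (adj_sym : forall i, symmetric (adj i)) (adj_trans : forall i, transitive (adj i))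
  (card_adj : forall i x, #|[pred y | adj i x y]| = q.+1).
Hypothesis adj_comm : forall i j, i != j -> ~~ nb i j -> forall x z,
  (\sum_y (adj i x y && adj j y z) = \sum_y (adj j x y && adj i y z))%N.
(** Divided by [(q + 1)^3], the number of galleries of type [(i, j, i)] is an entry of
    [P_i P_j P_i]. *)
Definition galleries i j x z : nat :=
  \sum_y \sum_y' [&& adj i x y, adj j y y' & adj i y' z].
(** The relation [braid] times [(q + 1)^3], with the subtracted terms moved across so that only
    natural numbers occur. *)
Hypothesis adj_braid : forall i j, i != j -> nb i j -> forall x z,
  (galleries i j x z + q * adj j x z = galleries j i x z + q * adj i x z)%N.
(** Gallery connectivity in the form used below: the joint fixed vectors of the averaging operators
    are the constants. *)
Hypothesis adj_conn : forall f : T -> R,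
  (forall i x y, adj i x y -> f x = f y) -> forall x y, f x = f y.
Hypothesis nb_le2 : forall i, (\sum_j nb i j <= 2)%N.
Hypothesis q0 : (0 < q)%N.

Let n := #|T|.
Let ev : 'I_n -> T := enum_val.
Let q1 : R := q.+1%:R.
Let q1n0 : q1 != 0. Proof. by rewrite pnatr_eq0. Qed.

Definition adj_proj i : 'M[R]_n := \matrix_(a, b) ((adj i (ev a) (ev b))%:R / q1).
Definition row_of (f : T -> R) : 'rV[R]_n := \row_a f (ev a).

Let sum_ev (F : T -> R) : \sum_a F (ev a) = \sum_x F x.
Proof. by rewrite [RHS](reindex ev) //; apply: onW_bij; exact: enum_val_bij. Qed.

Lemma dot_row_of f g : dot (row_of f) (row_of g) = \sum_x f x * g x.
Proof. by rewrite dotE -sum_ev; apply: eq_bigr => a _; rewrite !mxE. Qed.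

Lemma row_of_ev (v : 'rV[R]_n) : row_of (fun x => v 0 (enum_rank x)) = v.
Proof. by apply/rowP => a; rewrite mxE enum_valK. Qed.

Lemma adj_class i x y : adj i x y -> adj i x =1 adj i y.
Proof.
move=> xy z; apply/idP/idP; last exact: adj_trans.
by apply: adj_trans; rewrite adj_sym.
Qed.

Lemma sum_adj_nat i x : (\sum_y adj i x y)%N = q.+1.
Proof.
rewrite -(card_adj i x) -sum1_card [RHS]big_mkcond /=.
by apply: eq_bigr => y _; rewrite inE; case: adj.
Qed.

Lemma sum_adj i x : \sum_y (adj i x y)%:R = q1.
Proof. by rewrite -natr_sum sum_adj_nat. Qed.

Lemma adj_projM i j a b : (adj_proj i *m adj_proj j) a b =
  (\sum_y (adj i (ev a) y && adj j y (ev b)))%:R / q1 ^+ 2.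
Proof.
rewrite mxE natr_sum mulr_suml -sum_ev; apply: eq_bigr => c _.
by rewrite !mxE -mulnb natrM; field; rewrite ?nat1r.
Qed.

Lemma adj_projM3 i j a b : (adj_proj i *m adj_proj j *m adj_proj i) a b =
  (galleries i j (ev a) (ev b))%:R / q1 ^+ 3.
Proof.
rewrite mxE /galleries exchange_big natr_sum mulr_suml -sum_ev /=.
apply: eq_bigr => c _; rewrite adj_projM mxE !natr_sum !mulr_suml.
apply: eq_bigr => y _; rewrite andbA -[in RHS]mulnb natrM.
by field; rewrite ?nat1r.
Qed.

Lemma adj_proj_orthoproj i : orthoproj (adj_proj i).
Proof.
split; first by apply/matrixP => a b; rewrite !mxE adj_sym.
apply/matrixP => a b; rewrite adj_projM mxE.
have -> : (\sum_y (adj i (ev a) y && adj i y (ev b)) = q.+1 * adj i (ev a) (ev b))%N.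
  have -> : (q.+1 = \sum_y adj i (ev a) y)%N by rewrite sum_adj_nat.
  rewrite big_distrl /=; apply: eq_bigr => y _.
  by case ay: (adj i (ev a) y) => //=; rewrite mul1n (adj_class ay).
by rewrite natrM -/q1; field; rewrite ?nat1r.
Qed.

Lemma row_of_proj i f : (forall x y, adj i x y -> f x = f y) ->
  row_of f *m adj_proj i = row_of f.
Proof.
move=> fi; apply/rowP => b; rewrite !mxE.
transitivity (\sum_x f (ev b) / q1 * (adj i (ev b) x)%:R).
  rewrite -sum_ev; apply: eq_bigr => a _; rewrite !mxE adj_sym.
  case ab: (adj i _ _); last by rewrite !(mul0r, mulr0).
  by rewrite (fi _ _ ab) mulr1 mul1r.
by rewrite -mulr_sumr sum_adj divfK.
Qed.

Lemma proj_row_of i f : row_of f *m adj_proj i = row_of f ->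
  forall x y, adj i x y -> f x = f y.
Proof.
move=> fP x y xy.
have E z : f z = \sum_t f t * (adj i t z)%:R / q1.
  have /rowP/(_ (enum_rank z)) := fP; rewrite !mxE /ev enum_rankK => <-.
  by rewrite -sum_ev; apply: eq_bigr => a _; rewrite !mxE /ev enum_rankK mulrA.
rewrite (E x) (E y); apply: eq_bigr => t _.
by rewrite ![adj i t _]adj_sym (adj_class xy).
Qed.

Let mu : R := q%:R / q1 ^+ 2.

Lemma adj_proj_braid i j : i != j -> nb i j -> braid mu (adj_proj i) (adj_proj j).
Proof.
move=> ij nij; apply/matrixP => a b; rewrite mxE [RHS]mxE !adj_projM3 !mxE.
have /(congr1 (fun m : nat => m%:R : R)) := adj_braid ij nij (ev a) (ev b).
rewrite !natrD !natrM => h.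
have -> : (galleries i j (ev a) (ev b))%:R = (galleries j i (ev a) (ev b))%:R
   + q%:R * (adj i (ev a) (ev b))%:R - q%:R * (adj j (ev a) (ev b))%:R :> R by rewrite -h addrK.
by rewrite /mu; field; rewrite ?nat1r.
Qed.

Lemma adj_proj_comm i j : i != j -> ~~ nb i j ->
  adj_proj i *m adj_proj j = adj_proj j *m adj_proj i.
Proof. by move=> ij nij; apply/matrixP => a b; rewrite !adj_projM adj_comm. Qed.

Let q1E : q1 = q%:R + 1 :> R. Proof. by rewrite /q1 -natr1. Qed.
Let qpos : 0 < q%:R :> R. Proof. by rewrite ltr0n. Qed.

Lemma mu_le : mu <= q%:R^-1.
Proof.
rewrite /mu ler_pdivrMr ?exprn_gt0 ?ltr0n // q1E mulrC ler_pdivlMr //.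
have := qpos; nra.
Qed.

Lemma mu_lt1 : mu < 1.
Proof. by rewrite /mu ltr_pdivrMr ?exprn_gt0 ?ltr0n // mul1r q1E; have := qpos; nra. Qed.

Lemma mu_ge0 : 0 <= mu.
Proof. by rewrite /mu divr_ge0 ?exprn_ge0 ?ler0n. Qed.

Definition mean (f : T -> R) := (\sum_x f x) / n%:R.

Let sq := Num.sqrt (q%:R : R).
Let sq0 : 0 < sq. Proof. by rewrite sqrtr_gt0. Qed.
Let sq2 : sq ^+ 2 = q%:R. Proof. by rewrite sqr_sqrtr // ltW. Qed.

(** Since [g] is fixed by [P_i], the covariance is [<f0 P_i, g> / n] with [f0 = f - mean f].
    Cauchy-Schwarz then uses [|f0 P_i|^2 <= 4 mu |f0|^2 <= 4 n / q] and [|g|^2 <= n]. *)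
Lemma covariance_le i (f g : T -> R) : (0 < n)%N -> 2 * d%:R <= sq ->
  (forall j x y, j != i -> adj j x y -> f x = f y) ->
  (forall x y, adj i x y -> g x = g y) ->
  (forall x, 0 <= f x <= 1) -> (forall x, 0 <= g x <= 1) ->
  `|mean (fun x => f x * g x) - mean f * mean g| <= 2 / sq.
Proof.
move=> n0 dq fi gi f01 g01; have nR : 0 < n%:R :> R by rewrite ltr0n.
have nn0 : n%:R != 0 :> R by rewrite gt_eqF.
set m := mean f; pose f0 x := f x - m.
have sumf0 : \sum_x f0 x = 0.
  by rewrite sumrB sumr_const -mulr_natl /m /mean -/n mulrC divfK // subrr.
have le_one (h : T -> R) : (forall x, 0 <= h x <= 1) -> \sum_x h x * h x <= n%:R.
  move=> h01; rewrite -[n%:R](sumr_const T) /=.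
  by apply: ler_sum => x _; have := h01 x; nra.
have cov : mean (fun x => f x * g x) - m * mean g = dot (row_of f0) (row_of g) / n%:R.
  rewrite dot_row_of /mean mulrA -mulrBl mulr_sumr -sumrB; congr (_ / _).
  by apply: eq_bigr => x _; rewrite mulrBl.
have f0P j : j != i -> row_of f0 *m adj_proj j = row_of f0.
  by move=> ji; apply: row_of_proj => x y xy; rewrite /f0 (fi j x y).
have f0c w : (forall j, w *m adj_proj j = w) -> dot (row_of f0) w = 0.
  move=> wP; rewrite -(row_of_ev w) dot_row_of.
  have wc x y : w 0 (enum_rank x) = w 0 (enum_rank y).
    pose wf (t : T) := w 0 (enum_rank t); have wfE : row_of wf = w := row_of_ev w.
    apply: (adj_conn (f := wf)) => j; apply: proj_row_of.
    by rewrite wfE.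
  case: (pickP T) => [x0 _|T0]; last by rewrite big1 // => x; have := T0 x.
  under eq_bigr => x _ do rewrite (wc x x0).
  by rewrite -mulr_suml sumf0 mul0r.
(* The choice [lam = 1 / sqrt q] meets both requirements of the gap: [mu <= 1 / q = lam^2] and
   [2 lam d <= 1]. *)
have lam2 : 2 * sq^-1 * d%:R <= 1.
  by rewrite mulrAC ler_pdivrMr // mul1r.
have mulam : 0 <= mu <= sq^-1 ^+ 2 by rewrite mu_ge0 exprVn sq2 mu_le.
have sqi0 : 0 < sq^-1 by rewrite invr_gt0.
have nb2 : \sum_j (nb i j)%:R <= 2 :> R by rewrite -natr_sum ler_nat.
have small := dot_proj_small adj_proj_orthoproj adj_proj_braid adj_proj_comm mulam
  mu_lt1 sqi0 lam2 nb2 f0P f0c.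
have ff : dot (row_of f0) (row_of f0) <= n%:R.
  apply: le_trans (le_one f f01); rewrite dot_row_of.
  have -> : \sum_x f x * f x = \sum_x f0 x * f0 x + m ^+ 2 * n%:R + 2 * m * \sum_x f0 x.
    rewrite mulr_sumr [m ^+ 2 * _]mulr_natr -sumr_const -!big_split /=.
    by apply: eq_bigr => x _; rewrite /f0; ring.
  by rewrite sumf0 mulr0 addr0 lerDl mulr_ge0 ?sqr_ge0 ?ltW.
have gg : dot (row_of g) (row_of g) <= n%:R by rewrite dot_row_of le_one.
rewrite cov normrM normfV (gtr0_norm nR) ler_pdivrMr //.
rewrite -(ler_pXn2r (n := 2)) ?nnegrE //; last first.
  by rewrite !mulr_ge0 ?ltW.
rewrite -normrX ger0_norm ?sqr_ge0 //.
have -> : dot (row_of f0) (row_of g) = dot (row_of f0 *m adj_proj i) (row_of g).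
  by rewrite dot_mulC ?(adj_proj_orthoproj i).1 // row_of_proj.
apply: (le_trans (cauchy_schwarz _ _)).
rewrite exprMn exprMn exprVn sq2.
have h1 : dot (row_of f0 *m adj_proj i) (row_of f0 *m adj_proj i) <= 4 / q%:R * n%:R.
  apply: (le_trans small); rewrite -[4 * mu * _]mulrA -[4 / _ * _]mulrA ler_pM2l //.
  by rewrite ler_pM ?mu_ge0 ?dot_ge0 ?mu_le.
apply: (@le_trans _ _ (4 / q%:R * n%:R * n%:R)).
  by rewrite ler_pM ?dot_ge0.
rewrite [X in _ <= X](_ : _ = 4 / q%:R * n%:R * n%:R) //; ring.
Qed.

(** * Products of events that each depend on one vertex *)

Section Events.
Variable W : 'I_d -> pred T.
Hypothesis WP : forall i j x y, j != i -> adj j x y -> W i x = W i y.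

Let f i x : R := (W i x)%:R.
Let prodf (s : seq 'I_d) x := \prod_(i <- s) f i x.

Let f01 i x : 0 <= f i x <= 1.
Proof. by rewrite /f; case: W; rewrite ?lexx ler01. Qed.

Let prodf01 s x : 0 <= prodf s x <= 1.
Proof.
rewrite /prodf; elim: s => [|i s IH]; first by rewrite big_nil ler01 lexx.
rewrite big_cons; have /andP[a0 a1] := f01 i x; have /andP[b0 b1] := IH.
by rewrite mulr_ge0 //= mulr_ile1.
Qed.

Lemma mean01 (g : T -> R) : (forall x, 0 <= g x <= 1) -> 0 <= mean g <= 1.
Proof.
move=> g01; rewrite /mean divr_ge0 ?ler0n ?sumr_ge0 //=; last by move=> x _; case/andP: (g01 x).
case: (posnP n) => [->|n0]; first by rewrite invr0 mulr0 ler01.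
rewrite ler_pdivrMr ?ltr0n // mul1r -[n%:R](sumr_const T) /=.
by apply: ler_sum => x _; case/andP: (g01 x).
Qed.

(** Telescoping: splitting off one indicator costs one covariance, at most [2 / sqrt q], and the
    error made so far is multiplied by a mean in [[0, 1]]. *)
Lemma mean_prod_le s : uniq s -> (0 < n)%N -> 2 * d%:R <= sq ->
  `|mean (prodf s) - \prod_(i <- s) mean (f i)| <= (size s)%:R * (2 / sq).
Proof.
move=> + n0 dq; elim: s => [|i s IH] /=.
  rewrite big_nil mul0r /mean /prodf; under eq_bigr do rewrite big_nil.
  by rewrite sumr_const divff ?subrr ?normr0 // pnatr_eq0 -lt0n.
move=> /andP[is_ us].
rewrite big_cons -natr1 mulrDl mul1r.
have /andP[mi0 mi1] := mean01 (f01 i).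
have -> : mean (prodf (i :: s)) = mean (fun x => f i x * prodf s x).
  by rewrite /mean; congr (_ / _); apply: eq_bigr => x _; rewrite /prodf big_cons.
have := @covariance_le i (f i) (prodf s) n0 dq.
move=> /(_ _ _ (f01 i) (prodf01 s)) C.
apply: le_trans (_ : `|mean (fun x => f i x * prodf s x) - mean (f i) * mean (prodf s)|
   + `|mean (f i) * (mean (prodf s) - \prod_(j <- s) mean (f j))| <= _).
  by apply: le_trans (ler_normD _ _); rewrite mulrBr addrA subrK.
rewrite [leRHS]addrC; apply: lerD.
  apply: C => [j x y ji xy|x y xy]; first by rewrite /f (WP ji xy).
  (* As [s] has no repetition, [i] does not occur in it, so no remaining indicator sees the vertex
     of type [i]. *)
  apply: eq_big_seq => j js; rewrite /f (WP _ xy) //.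
  by apply: contraNneq is_ => ->.
rewrite normrM (ger0_norm mi0); apply: le_trans (IH us).
by rewrite ler_piMl.
Qed.

Lemma mean_pred (A : pred T) : mean (fun x => (A x)%:R) = #|A|%:R / n%:R.
Proof.
by rewrite /mean -natr_sum -sum1_card [in RHS]big_mkcond.
Qed.

Theorem chamber_mixing : (0 < n)%N ->
  `| #|[pred x | [forall i, W i x]]|%:R / n%:R - \prod_i (#|W i|%:R / n%:R) |
    <= 2 * d%:R / Num.sqrt q%:R :> R.
Proof.
move=> n0; have allW : #|[pred x | [forall i, W i x]]|%:R / n%:R = mean (prodf (enum 'I_d)).
  rewrite -mean_pred /mean; congr (_ / _); apply: eq_bigr => x _.
  rewrite /prodf big_enum /= /f -natr_prod; congr _%:R.
  case: (boolP [forall i, W i x]) => [/forallP h|/forallPn[i ni]].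
    by rewrite big1 // => i _; rewrite h.
  by rewrite (bigD1 i) //= (negbTE ni) mul0n.
have prodW : \prod_i (#|W i|%:R / n%:R) = \prod_(i <- enum 'I_d) mean (f i) :> R.
  by rewrite big_enum /=; apply: eq_bigr => i _; rewrite mean_pred.
rewrite allW prodW -/sq; case: (lerP (2 * d%:R) sq) => [dq|dq].
  apply: (le_trans (mean_prod_le (enum_uniq 'I_d) n0 dq)).
  by rewrite size_enum_ord mulrCA mulrA.
(* For [sqrt q < 2 d] the bound exceeds 1, while both quantities compared lie in [[0, 1]]. *)
have /andP[a0 a1] := mean01 (prodf01 (enum 'I_d)).
have /andP[b0 b1] : 0 <= \prod_(i <- enum 'I_d) mean (f i) <= 1.
  rewrite big_enum /=; apply/andP; split; last first.
    by apply: prodr_ile1 => i _; apply: mean01; exact: f01.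
  by apply: prodr_ge0 => i _; case/andP: (mean01 (f01 i)).
apply: (@le_trans _ _ 1); last by rewrite ler_pdivlMr // mul1r ltW.
by rewrite ler_norml; apply/andP; split; lra.
Qed.

End Events.
End Mixing.

(** * Valuations *)

Section Valuation.
Variables (F : fieldType) (nu : F -> int).
Hypothesis dv : discrete_valuation nu.
Implicit Types x y : F.

Lemma nuM x y : x != 0 -> y != 0 -> nu (x * y) = nu x + nu y.
Proof. by case: dv => h _ _; exact: h. Qed.

Lemma nu1 : nu 1 = 0.
Proof. by apply: (@addrI _ (nu 1)); rewrite -nuM ?oner_neq0 // mulr1 addr0. Qed.

Lemma nuV x : x != 0 -> nu x^-1 = - nu x.
Proof.
move=> x0; have xV : x^-1 != 0 by rewrite invr_eq0.
by have := nuM x0 xV; rewrite divff // nu1; lia.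
Qed.

Lemma nuN x : x != 0 -> nu (- x) = nu x.
Proof.
move=> x0; have n1 : -1 != 0 :> F by rewrite oppr_eq0 oner_eq0.
have := nuM n1 n1; rewrite mulrNN mulr1 nu1 => h.
by rewrite -mulN1r nuM //; lia.
Qed.

Lemma nu_exprn x (n : nat) : x != 0 -> nu (x ^+ n) = n%:Z * nu x.
Proof.
move=> x0; elim: n => [|n IH]; first by rewrite expr0 nu1 mul0r.
by rewrite exprS nuM ?expf_neq0 // IH; lia.
Qed.

Lemma nu_exprz x (n : int) : x != 0 -> nu (x ^ n) = n * nu x.
Proof.
by move=> x0; case: n => n; [exact: nu_exprn | rewrite NegzE -exprnN nuV ?expf_neq0 // nu_exprn //; lia].
Qed.

Lemma intO0 : intO nu 0. Proof. by left. Qed.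
Lemma intO1 : intO nu 1. Proof. by right; rewrite nu1. Qed.

Lemma intO_neq0 x : intO nu x -> x != 0 -> 0 <= nu x.
Proof. by case=> // ->; rewrite eqxx. Qed.

Lemma intOD x y : intO nu x -> intO nu y -> intO nu (x + y).
Proof.
move=> ox oy; have [->|x0] := eqVneq x 0; first by rewrite add0r.
have [->|y0] := eqVneq y 0; first by rewrite addr0.
have [->|xy0] := eqVneq (x + y) 0; first exact: intO0.
case: dv => _ h _; right; apply: le_trans (h _ _ x0 y0 xy0).
by rewrite le_min !intO_neq0.
Qed.

Lemma intOM x y : intO nu x -> intO nu y -> intO nu (x * y).
Proof.
move=> ox oy; have [->|x0] := eqVneq x 0; first by rewrite mul0r; left.
have [->|y0] := eqVneq y 0; first by rewrite mulr0; left.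
by right; rewrite nuM // addr_ge0 // intO_neq0.
Qed.

Lemma intON x : intO nu x -> intO nu (- x).
Proof.
move=> ox; have [->|x0] := eqVneq x 0; first by rewrite oppr0; left.
by right; rewrite nuN // intO_neq0.
Qed.

Lemma intO_sum (I : finType) (G : I -> F) : (forall i, intO nu (G i)) -> intO nu (\sum_i G i).
Proof. by move=> h; apply: (big_ind (intO nu)) => //; [exact: intO0 | exact: intOD]. Qed.

Lemma intO_prod (I : finType) (G : I -> F) : (forall i, intO nu (G i)) -> intO nu (\prod_i G i).
Proof. by move=> h; apply: (big_ind (intO nu)) => //; [exact: intO1 | exact: intOM]. Qed.

Lemma intO_sign (b : nat) : intO nu ((-1) ^+ b).
Proof.
elim: b => [|b IH]; first by rewrite expr0; exact: intO1.
by rewrite exprS; apply: intOM => //; apply: intON; exact: intO1.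
Qed.

Lemma intO_div x y : y != 0 -> (x = 0 \/ nu y <= nu x) -> intO nu (x / y).
Proof.
move=> y0 [->|xy]; first by rewrite mul0r; left.
have [->|x0] := eqVneq x 0; first by rewrite mul0r; left.
by right; rewrite nuM ?invr_eq0 // nuV // subr_ge0.
Qed.

Section Matrices.
Variable m n p : nat.
Definition intmx (k l : nat) (A : 'M[F]_(k, l)) := forall i j, intO nu (A i j).

Lemma intmx_mul (A : 'M_(m, n)) (B : 'M_(n, p)) : intmx A -> intmx B -> intmx (A *m B).
Proof. by move=> hA hB i j; rewrite mxE; apply: intO_sum => k; apply: intOM. Qed.

Lemma intmx_det (A : 'M_n) : intmx A -> intO nu (\det A).
Proof.
by move=> hA; apply: intO_sum => s; apply: intOM; [exact: intO_sign | exact: intO_prod].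
Qed.
End Matrices.

(** Cramer's rule: the cofactors are integral and the determinant is a unit of the valuation
    ring. *)
Lemma intmx_inv (n : nat) (A : 'M[F]_n) : intmx A -> A \in unitmx -> nu (\det A) = 0 ->
  intmx (invmx A).
Proof.
move=> hA uA dA i j; rewrite /invmx uA !mxE.
have d0 : \det A != 0 by rewrite -unitfE -unitmxE.
apply: intOM; first by right; rewrite nuV // dA.
by rewrite /cofactor; apply: intOM (intO_sign _) _; apply: intmx_det => a b; rewrite !mxE.
Qed.

End Valuation.

(** * Lattices *)

Section ScaleAct.
Variables (F : fieldType) (d : nat).
Implicit Types (L A B : set 'cV[F]_d) (c e : F) (g h : 'M[F]_d) (x v : 'cV[F]_d).

Lemma mem_scale c L x : c != 0 -> scale_set c L x <-> L (c^-1 *: x).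
Proof.
move=> c0; split; first by case=> y Ly <-; rewrite scalerA mulVf // scale1r.
by move=> h; exists (c^-1 *: x) => //; rewrite scalerA mulfV // scale1r.
Qed.

Lemma scale_setM c e L : scale_set c (scale_set e L) = scale_set (c * e) L.
Proof. by rewrite /scale_set image_comp; congr image; apply/funext => x /=; rewrite scalerA. Qed.

Lemma scale_set1 L : scale_set 1 L = L.
Proof.
by rewrite /scale_set -[RHS]image_id; congr image; apply/funext => x; rewrite scale1r.
Qed.

Lemma scale_setS c A B : A `<=` B -> scale_set c A `<=` scale_set c B.
Proof. exact: image_subset. Qed.

Lemma actM g h L : act g (act h L) = act (g *m h) L.
Proof. by rewrite /act image_comp; congr image; apply/funext => x /=; rewrite mulmxA. Qed.

Lemma act1 L : act 1%:M L = L.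
Proof. by rewrite /act -[RHS]image_id; congr image; apply/funext => x; rewrite mul1mx. Qed.

Lemma actK g L : g \in unitmx -> act (invmx g) (act g L) = L.
Proof. by move=> ug; rewrite actM mulVmx // act1. Qed.

Lemma actS g A B : A `<=` B -> act g A `<=` act g B.
Proof. exact: image_subset. Qed.

Lemma act_scale g c L : act g (scale_set c L) = scale_set c (act g L).
Proof.
by rewrite /act /scale_set !image_comp; congr image; apply/funext => x /=; rewrite scalemxAr.
Qed.

Lemma act_scalar c L : act c%:M L = scale_set c L.
Proof. by congr image; apply/funext => x; rewrite mul_scalar_mx. Qed.

End ScaleAct.

Section Lattices.
Variables (F : fieldType) (nu : F -> int) (d : nat).
Hypothesis dv : discrete_valuation nu.
Local Notation vec := 'cV[F]_d.
Implicit Types (L A B M : set vec) (g h : 'M[F]_d) (x y v : vec).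

(** The degree does not depend on the basis [g] ([hasdeg_uniq]) and grows as the lattice shrinks:
    for [B] inside [A] the difference of the degrees is the length of [A / B]. *)
Definition hasdeg L (n : int) :=
  exists g, [/\ g \in unitmx, L = lattice_of nu g & nu (\det g) = n].

Lemma is_lattice_hasdeg L : is_lattice nu L <-> exists n, hasdeg L n.
Proof.
split; first by case=> g [ug ->]; exists (nu (\det g)), g.
by case=> n [g [ug -> _]]; exists g.
Qed.

Lemma hasdeg_lattice L n : hasdeg L n -> is_lattice nu L.
Proof. by move=> h; apply/is_lattice_hasdeg; exists n. Qed.

Lemma unit_det g : g \in unitmx -> \det g != 0.
Proof. by rewrite unitmxE unitfE. Qed.

Lemma mem_lattice g v : g \in unitmx ->
  lattice_of nu g v <-> forall i, intO nu ((invmx g *m v) i 0).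
Proof.
move=> ug; split; first by case=> w hw <-; rewrite mulKmx.
by move=> h; exists (invmx g *m v) => //; rewrite mulKVmx.
Qed.

Lemma std_intmx v : (forall i, intO nu (v i 0)) -> intmx nu v.
Proof. by move=> h i j; rewrite ord1. Qed.

Lemma lattice_sub g h : g \in unitmx ->
  lattice_of nu h `<=` lattice_of nu g <-> intmx nu (invmx g *m h).
Proof.
move=> ug; split => [sub i j|int v [w hw <-]].
  have /sub/(mem_lattice _ ug) : lattice_of nu h (h *m delta_mx j 0).
    exists (delta_mx j 0) => // k; rewrite mxE.
    by case: (_ && _); [exact: intO1 | exact: intO0].
  by move=> /(_ i); rewrite mulmxA -colE mxE.
apply/(mem_lattice _ ug) => i; rewrite mulmxA.
exact: (intmx_mul dv int (std_intmx hw)).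
Qed.

(** The base change [g^-1 h] is integral, so its determinant has valuation [b - a >= 0]; if this is
    zero, the inverse is integral too. *)
Lemma hasdeg_sub A B a b : hasdeg A a -> hasdeg B b -> B `<=` A ->
  a <= b /\ (a = b -> A = B).
Proof.
move=> [g [ug -> <-]] [h [uh -> <-]] /(lattice_sub _ ug) int.
have gh0 : \det (invmx g) != 0 by rewrite unit_det // unitmx_inv.
have D : nu (\det (invmx g *m h)) = nu (\det h) - nu (\det g).
  by rewrite det_mulmx (nuM dv gh0) ?unit_det // det_inv (nuV dv) ?unit_det // addrC.
have gh1 : \det (invmx g *m h) != 0 by rewrite det_mulmx mulf_neq0 // unit_det.
have := intO_neq0 (intmx_det dv int) gh1; rewrite D => D0; split; first lia.
move=> e; apply/seteqP; split; last exact/lattice_sub.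
apply/(lattice_sub _ uh).
have -> : invmx h *m g = invmx (invmx g *m h).
  have ugh : invmx g *m h \in unitmx by rewrite unitmx_mul unitmx_inv ug.
  rewrite -[LHS]mulmx1 -(mulmxV ugh) mulmxA -(mulmxA (invmx h)) mulKVmx //.
  by rewrite mulVmx // mul1mx.
apply: intmx_inv => //; first by rewrite unitmx_mul unitmx_inv ug.
by rewrite D; lia.
Qed.

Lemma hasdeg_uniq L a b : hasdeg L a -> hasdeg L b -> a = b.
Proof.
move=> ha hb; have [ab _] := hasdeg_sub ha hb (@subset_refl _ L).
by have [ba _] := hasdeg_sub hb ha (@subset_refl _ L); lia.
Qed.

Lemma hasdeg_eq A B a : hasdeg A a -> hasdeg B a -> B `<=` A -> A = B.
Proof. by move=> ha hb s; have [_] := hasdeg_sub ha hb s; exact. Qed.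

Definition omodule L := [/\ L 0, (forall x y, L x -> L y -> L (x + y))
  & forall s x, intO nu s -> L x -> L (s *: x)].

Lemma hasdeg_omodule L n : hasdeg L n -> omodule L.
Proof.
case=> g [ug -> _]; split=> [|x y|s x os] .
- by exists 0; rewrite ?mulmx0 // => i; rewrite mxE; exact: intO0.
- move=> [v hv <-] [w hw <-]; exists (v + w); rewrite ?mulmxDr // => i.
  by rewrite mxE; apply: intOD.
- move=> [v hv <-]; exists (s *: v); rewrite -?scalemxAr // => i.
  by rewrite mxE; apply: intOM.
Qed.

Lemma omoduleB L x y : omodule L -> L x -> L y -> L (x - y).
Proof.
move=> [_ D Z] hx hy; apply: D => //; rewrite -scaleN1r; apply: Z => //.
by apply: intON => //; exact: intO1.
Qed.

Lemma scale_unit L c : omodule L -> c != 0 -> nu c = 0 -> scale_set c L = L.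
Proof.
move=> [_ _ Z] c0 nc; apply/seteqP; split=> x.
  by move=> [y hy <-]; apply: Z => //; right; rewrite nc.
by move=> hx; apply/mem_scale => //; apply: Z => //; right; rewrite nuV // nc.
Qed.

Lemma hasdeg_scale L n c : c != 0 -> hasdeg L n ->
  hasdeg (scale_set c L) (n + d%:Z * nu c).
Proof.
move=> c0 [g [ug -> <-]]; exists (c *: g); split.
- by rewrite unitmxE detZ unitfE mulf_neq0 ?expf_neq0 ?unit_det.
- by rewrite /scale_set /lattice_of image_comp; congr image; apply/funext => x /=; rewrite scalemxAl.
- by rewrite detZ nuM ?expf_neq0 ?unit_det // nu_exprn // addrC.
Qed.

Lemma hasdeg_act L n g : g \in unitmx -> hasdeg L n ->
  hasdeg (act g L) (n + nu (\det g)).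
Proof.
move=> ug [h [uh -> <-]]; exists (g *m h); split.
- by rewrite unitmx_mul ug.
- by rewrite /act /lattice_of image_comp; congr image; apply/funext => x /=; rewrite mulmxA.
- by rewrite det_mulmx nuM ?unit_det // addrC.
Qed.

(** Scaling by [c] shifts the degree by [d nu(c)]; equal degrees force [nu(c) = 0], and units
    preserve a lattice. *)
Lemma hasdeg_scale_eq A B n c : c != 0 -> hasdeg A n -> hasdeg B n ->
  (0 < d)%N -> B = scale_set c A -> B = A.
Proof.
move=> c0 hA hB d0 e; rewrite e in hB *; apply: scale_unit => //.
  exact: hasdeg_omodule hA.
have /eqP := hasdeg_uniq hB (hasdeg_scale c0 hA).
by rewrite -subr_eq0 opprD addrA subrr sub0r oppr_eq0 mulf_eq0 => /orP[|/eqP//]; lia.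
Qed.

Lemma std_exists : exists L, hasdeg L 0.
Proof. by exists (lattice_of nu 1%:M), 1%:M; rewrite unitmx1 det1 nu1. Qed.

Definition addO L x := [set v | exists y s, [/\ L y, intO nu s & v = y + s *: x]].

Lemma sub_addO L x : L `<=` addO L x.
Proof. by move=> y hy; exists y, 0; split; rewrite ?scale0r ?addr0 //; exact: intO0. Qed.

Lemma mem_addO L x : omodule L -> addO L x x.
Proof. by case=> h _ _; exists 0, 1; split; rewrite ?scale1r ?add0r //; exact: intO1. Qed.

Lemma addO_sub L A x : omodule A -> L `<=` A -> A x -> addO L x `<=` A.
Proof. by move=> [_ D Z] LA Ax v [y [s [hy hs ->]]]; apply: D; [exact: LA|exact: Z]. Qed.

Lemma det_set_col (y : vec) j :
  \det (\matrix_(i, k) (if k == j then y i 0 else (i == k)%:R)) = y j 0.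
Proof.
set N := \matrix_(i, k) _; rewrite (expand_det_row N j) (bigD1 j) //= big1; last first.
  by move=> k kj; rewrite mxE (negbTE kj) eq_sym (negbTE kj) mul0r.
rewrite addr0 mxE eqxx /cofactor addnn -signr_odd odd_double expr0 mul1r.
rewrite (_ : row' j (col' j N) = 1%:M) ?det1 ?mulr1 //.
by apply/matrixP => a b; rewrite !mxE eq_sym (negbTE (neq_lift _ _)) (inj_eq (@lift_inj _ j)).
Qed.

Variable pi : F.
Hypotheses (pi0 : pi != 0) (nupi : nu pi = 1).

Lemma intO_pi : intO nu pi. Proof. by right; rewrite nupi. Qed.

Lemma omodule_pi L x : omodule L -> L x -> L (pi *: x).
Proof. by move=> [_ _ Z]; apply: Z; exact: intO_pi. Qed.

(** In a basis of [L] some coordinate [j] of [x] has valuation exactly [-1], the least possible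
    because [pi x] lies in [L]. Exchanging the [j]-th basis vector for [x] gives a basis of
    [L + O x] and multiplies the determinant by that coordinate. *)
Lemma hasdeg_addO L n x : hasdeg L n -> ~ L x -> L (pi *: x) -> hasdeg (addO L x) (n - 1).
Proof.
move=> [g [ug -> <-]]; set y := invmx g *m x.
have xE : x = g *m y by rewrite mulKVmx.
move=> /(mem_lattice _ ug)/existsNP[j yj] /(mem_lattice _ ug).
rewrite -scalemxAr -/y => piy; rewrite -/y in yj; clearbody y.
have y0 : y j 0 != 0 by apply/eqP => e; apply: yj; rewrite e; exact: intO0.
have nuy i : y i 0 = 0 \/ -1 <= nu (y i 0).
  have [->|yi] := eqVneq (y i 0) 0; [by left | right].
  have := intO_neq0 (piy i); rewrite mxE mulf_eq0 negb_or pi0 yi => /(_ isT).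
  by rewrite nuM // nupi -lerBlDl sub0r.
have nyj : nu (y j 0) = -1.
  have [/eqP|] := nuy j; first by rewrite (negbTE y0).
  have : ~ 0 <= nu (y j 0) by move=> h; apply: yj; right.
  by move: (nu _) => t; lia.
pose N : 'M[F]_d := \matrix_(i, k) (if k == j then y i 0 else (i == k)%:R).
have dN : \det N = y j 0 by exact: det_set_col.
have uN : N \in unitmx by rewrite unitmxE unitfE dN.
have NE (w : vec) i : (N *m w) i 0 = (if i == j then 0 else w i 0) + w j 0 * y i 0.
  rewrite mxE (bigD1 j) //= mxE eqxx addrC [y i 0 * _]mulrC; congr (_ + _).
  have [->|ij] := eqVneq i j.
    by rewrite big1 // => k kj; rewrite mxE (negbTE kj) eq_sym (negbTE kj) mul0r.
  rewrite (bigD1 i) //= big1 ?addr0; first by rewrite mxE (negbTE ij) eqxx mul1r.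
  by move=> k /andP[kj ki]; rewrite mxE (negbTE kj) eq_sym (negbTE ki) mul0r.
exists (g *m N); split; first by rewrite unitmx_mul ug.
  apply/seteqP; split=> v.
    move=> [_ [s [[u hu <-] os ->]]]; rewrite xE scalemxAr -mulmxDr.
    have uj : intO nu (u j 0 / y j 0).
      by apply: intO_div => //; case: (hu j) => h; [left | right; rewrite nyj; apply: le_trans h].
    (* Coordinates in the new basis: the multiple [u_j / y_j] of [x] absorbs the [j]-th coordinate
       of [u], and all quotients by [y_j] are integral as its valuation is minimal. *)
    exists (\col_i (if i == j then s + u j 0 / y j 0 else u i 0 - u j 0 / y j 0 * y i 0)).
      move=> i; rewrite mxE; case: ifP => _; first exact: intOD.
      apply: intOD => //; apply: intON => //; rewrite -mulrA; apply: intOM => //.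
      by rewrite mulrC; apply: intO_div => //; case: (nuy i) => h; [left | right; rewrite nyj].
    rewrite -mulmxA; congr (g *m _); apply/colP => i; rewrite NE !mxE eqxx.
    by have [->|ij] := eqVneq i j; field.
  move=> [w hw <-]; exists (g *m (\col_i (if i == j then 0 else w i 0))), (w j 0); split.
  - exists (\col_i (if i == j then 0 else w i 0)) => // i; rewrite mxE.
    by case: ifP => _; [exact: intO0 | exact: hw].
  - exact: hw.
  - rewrite xE scalemxAr -mulmxDr -mulmxA; congr (g *m _); apply/colP => i.
    by rewrite NE !mxE.
by rewrite det_mulmx dN nuM ?unit_det // nyj.
Qed.

Lemma pi_pow_mem L n x : hasdeg L n -> exists k : nat, L (pi ^+ k *: x).
Proof.
move=> [g [ug -> _]]; set y := invmx g *m x.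
pose k := (\sum_i `|nu (y i ord0)|)%N.
exists k; apply/(mem_lattice _ ug) => i; rewrite -scalemxAr -/y mxE.
have [->|yi] := eqVneq (y i 0) 0; first by rewrite mulr0; exact: intO0.
right; rewrite nuM ?expf_neq0 // nu_exprn // nupi.
have : (`|nu (y i 0%R)| <= k)%N by rewrite /k (bigD1 i) //= leq_addr.
by clearbody k; move: (nu (y i 0)) => t; lia.
Qed.

End Lattices.

(** * Intervals of lattices *)

Section LatticeIntervals.
Variables (F : fieldType) (nu : F -> int) (d : nat) (pi : F).
Hypotheses (dv : discrete_valuation nu) (pi0 : pi != 0) (nupi : nu pi = 1).
Local Notation vec := 'cV[F]_d.
Local Notation hasdeg := (hasdeg nu).
Implicit Types (L A B D M N S : set vec) (x y v : vec).

Let om L n : hasdeg L n -> omodule nu L. Proof. exact: hasdeg_omodule. Qed.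

(** Multiply a vector of [N] outside [B] by [pi] as long as it stays outside; some power of [pi]
    moves it into [B]. *)
Lemma exists_pi_step N B b : omodule nu N -> hasdeg B b -> ~ (N `<=` B) ->
  exists x, [/\ N x, ~ B x & B (pi *: x)].
Proof.
move=> [_ _ Z] hB /existsNP[x /not_implyP[Nx Bx]].
have [k] := pi_pow_mem dv pi0 nupi x hB.
elim: k => [|k IH]; first by rewrite expr0 scale1r.
case: (pselect (B (pi ^+ k *: x))) => [/IH//|nB]; rewrite exprS -scalerA => h.
exists (pi ^+ k *: x); split => //; apply: Z => //.
by right; rewrite nu_exprn // nupi; lia.
Qed.

Lemma hasdeg_lt A a B b : hasdeg A a -> hasdeg B b -> B `<=` A -> ~ (A `<=` B) -> a < b.
Proof.
move=> hA hB BA nAB; have [ab e] := hasdeg_sub dv hA hB BA.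
rewrite lt_neqAle ab andbT; apply/eqP => h; apply: nAB; by rewrite (e h).
Qed.

(** Enlarge [B] inside [N] by one [pi]-step at a time. Each step lowers the degree by one, and it
    cannot fall below [a], so [N] is reached. This makes the intersections and sums below
    lattices. *)
Lemma omodule_between A a B b N : hasdeg A a -> hasdeg B b -> B `<=` N -> N `<=` A ->
  omodule nu N -> exists n, hasdeg N n.
Proof.
move=> hA + + NA oN; have [k hk] : exists k : nat, `|b - a|%N = k by eexists.
elim: k b B hk => [|k IH] b B hk hB BN.
all: have BA : B `<=` A by apply: subset_trans NA.
all: have [ab e] := hasdeg_sub dv hA hB BA.
  have {}e := e ltac:(lia); exists b; rewrite (_ : N = B) //.
  by apply/seteqP; split=> //; rewrite -e.
case: (pselect (N `<=` B)) => NB; first by exists b; rewrite (_ : N = B) //; exact/seteqP.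
have [x [Nx Bx pix]] := exists_pi_step oN hB NB.
have hx := hasdeg_addO dv pi0 nupi hB Bx pix.
have xN : addO nu B x `<=` N by exact: addO_sub.
apply: (IH (b - 1) _ _ hx) => //.
have [h _] := hasdeg_sub dv hA hx (subset_trans xN NA); lia.
Qed.

Lemma exists_between A a B b n : hasdeg A a -> hasdeg B b -> B `<=` A -> a <= n <= b ->
  exists M, [/\ hasdeg M n, B `<=` M & M `<=` A].
Proof.
move=> hA + + /andP[an]; have [k hk] : exists k : nat, `|b - n|%N = k by eexists.
elim: k b B hk => [|k IH] b B hk hB BA nb.
  by exists B; split => //; rewrite (_ : n = b) //; lia.
have nAB : ~ (A `<=` B) by move=> AB; have [] := hasdeg_sub dv hB hA AB; lia.
have [x [Ax Bx pix]] := exists_pi_step (om hA) hB nAB.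
have hx := hasdeg_addO dv pi0 nupi hB Bx pix.
have xA : addO nu B x `<=` A by apply: addO_sub => //; exact: om hA.
have [||M [hM xM MA]] := IH (b - 1) _ _ hx xA; [lia|lia|].
exists M; split => //; apply: subset_trans xM; exact: sub_addO.
Qed.

Lemma addO_eq D n M x : hasdeg D (n + 1) -> hasdeg M n -> D `<=` M -> M x -> ~ D x ->
  D (pi *: x) -> M = addO nu D x.
Proof.
move=> hD hM DM Mx Dx pix; have := hasdeg_addO dv pi0 nupi hD Dx pix; rewrite addrK => hx.
by apply: (hasdeg_eq dv hM hx); apply: addO_sub => //; exact: om hM.
Qed.

(** Nakayama's lemma for [L / D]. If [pi^k x] is outside [D] and [pi^(k+1) x] inside, then
    [L = D + O pi^k x]. For [k > 0] this gives [x = y + s pi^k x] with [y] in [D], and as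
    [1 - s pi^k] is a unit, [x] would lie in [D]. *)
Lemma pi_mul_colength1 L n D x : hasdeg L n -> hasdeg D (n + 1) -> D `<=` L -> L x ->
  D (pi *: x).
Proof.
move=> hL hD DL Lx; have oD := om hD; have [oD0 oDD oDZ] := oD.
case: (pselect (D x)) => Dx; first exact: omodule_pi oD Dx.
have [k] := pi_pow_mem dv pi0 nupi x hD.
elim: k => [|k IH]; first by rewrite expr0 scale1r.
case: (pselect (D (pi ^+ k *: x))) => [/IH//|nB h].
have Lk : L (pi ^+ k *: x).
  by have [_ _ Z] := om hL; apply: Z => //; right; rewrite nu_exprn // nupi; lia.
have LE := addO_eq hD hL DL Lk nB; rewrite scalerA -exprS in LE; move: (LE h) Lx => -> [y [s [Dy os xE]]].
case: k => [|k] in IH nB h Lk LE xE *; first by move: h; rewrite expr1.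
case: Dx; have u0 : 1 - s * pi ^+ k.+1 != 0.
  apply/eqP => /eqP; rewrite subr_eq0 => /eqP e.
  have s0 : s != 0 by apply: contra_eq_neq e => ->; rewrite mul0r oner_eq0.
  have := nu1 dv; rewrite {1}e nuM ?expf_neq0 // nu_exprn // nupi.
  have := intO_neq0 os s0; move: (nu s) => t; lia.
have -> : x = (1 - s * pi ^+ k.+1)^-1 *: y.
  have -> : y = (1 - s * pi ^+ k.+1) *: x by rewrite scalerBl scale1r {1}xE scalerA addrK.
  by rewrite scalerA mulVf // scale1r.
apply: oDZ => //.
have ou : intO nu (s * pi ^+ k.+1).
  by apply: intOM => //; right; rewrite nu_exprn // nupi; lia.
(* Otherwise [1] would be a sum of two elements of positive valuation. *)
right; rewrite nuV // oppr_ge0 leNgt; apply/negP => up.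
have : 1 <= nu 1.
  have e1 : (1 - s * pi ^+ k.+1) + s * pi ^+ k.+1 = 1 :> F by rewrite subrK.
  have [s0|s0] := eqVneq s 0.
    by move: up; rewrite s0 mul0r subr0.
  have sp0 : s * pi ^+ k.+1 != 0 by rewrite mulf_neq0 ?expf_neq0.
  case: dv => _ hmin _; have := hmin _ _ u0 sp0; rewrite e1 oner_eq0 => /(_ isT).
  apply: le_trans; rewrite le_min; apply/andP; split; first by move: (nu _) up => t; lia.
  rewrite nuM ?expf_neq0 // nu_exprn // nupi.
  by have := intO_neq0 os s0; move: (nu s) => t; lia.
by rewrite nu1.
Qed.

Lemma exists_colength1_elt L n D : hasdeg L n -> hasdeg D (n + 1) -> D `<=` L ->
  exists x, [/\ L x, ~ D x & L = addO nu D x].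
Proof.
move=> hL hD DL; have nLD : ~ (L `<=` D).
  by move=> LD; have [] := hasdeg_sub dv hD hL LD; lia.
have [x [Lx Dx pix]] := exists_pi_step (om hL) hD nLD.
by exists x; split => //; apply: (addO_eq hD hL).
Qed.

Lemma omoduleI M N : omodule nu M -> omodule nu N -> omodule nu (M `&` N).
Proof.
move=> [M0 MD MZ] [N0 ND NZ]; split => //.
  by move=> x y [Mx Nx] [My Ny]; split; [exact: MD|exact: ND].
by move=> s x os [Mx Nx]; split; [exact: MZ|exact: NZ].
Qed.

Definition sumset M N := [set v | exists x y, [/\ M x, N y & v = x + y]].

Lemma omodule_sum M N : omodule nu M -> omodule nu N -> omodule nu (sumset M N).
Proof.
move=> [M0 MD MZ] [N0 ND NZ]; split.
- by exists 0, 0; rewrite addr0.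
- move=> _ _ [x [y [Mx Ny ->]]] [x' [y' [Mx' Ny' ->]]].
  by exists (x + x'), (y + y'); rewrite addrACA; split => //; [exact: MD|exact: ND].
- move=> s _ os [x [y [Mx Ny ->]]]; exists (s *: x), (s *: y); rewrite scalerDr.
  by split => //; [exact: MZ|exact: NZ].
Qed.

(** For [u] in [M] outside [M'] one has [A = M' + O u], whence [M = D + O u] by the modular law, so
    [D] has colength one in [M]. The common sublattice [B] shows that [D] is a lattice. *)
Lemma hasdeg_meet A a B b M M' : hasdeg A a -> hasdeg B b ->
  hasdeg M (a + 1) -> hasdeg M' (a + 1) -> M `<=` A -> M' `<=` A ->
  B `<=` M -> B `<=` M' -> M <> M' -> hasdeg (M `&` M') (a + 2).
Proof.
move=> hA hB hM hM' MA M'A BM BM' MM'; set D := M `&` M'.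
have DM : D `<=` M by move=> x [].
have [n hD] : exists n, hasdeg D n.
  apply: (omodule_between hA hB).
  - by move=> x Bx; split; [exact: BM|exact: BM'].
  - by apply: subset_trans MA.
  - by apply: omoduleI; [exact: om hM|exact: om hM'].
have nMM' : ~ (M `<=` M') by move=> s; apply: MM'; rewrite (hasdeg_eq dv hM' hM s).
have n2 : a + 2 <= n.
  have : a + 1 < n by apply: (hasdeg_lt hM hD) => // h; apply: nMM' => x /h [].
  lia.
suff : n <= a + 2 by move=> n2'; rewrite (_ : a + 2 = n) //; lia.
rewrite leNgt; apply/negP => n3.
move: nMM' => /existsNP[u /not_implyP[Mu M'u]].
have piu : D (pi *: u).
  split; first exact: omodule_pi (om hM) Mu.
  by apply: (pi_mul_colength1 hA hM') => //; exact: MA.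
have Du : ~ D u by case.
have hu := hasdeg_addO dv pi0 nupi hD Du piu.
have uM : addO nu D u `<=` M by apply: addO_sub => //; exact: om hM.
have AE : A = addO nu M' u.
  by apply: (addO_eq hM' hA) => //; [exact: MA|exact: piu.2].
suff Mu' : M `<=` addO nu D u by have [] := hasdeg_sub dv hu hM Mu'; lia.
move=> v Mv; have := MA _ Mv; rewrite AE => -[y [s [M'y os vE]]].
exists y, s; split => //; split => //.
have -> : y = v - s *: u by rewrite vE addrK.
apply: omoduleB; [exact: dv|exact: om hM|exact: Mv|].
by have [_ _ Z] := om hM; exact: Z.
Qed.

(** For [x] in [M'] outside [M] one has [M' = B + O x], so [M + M' = M + O x]. The last clause,
    minimality, later gives uniqueness in the rank two residues. *)
Lemma hasdeg_join A a B b M M' : hasdeg A a -> hasdeg B b ->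
  hasdeg M (b - 1) -> hasdeg M' (b - 1) -> M `<=` A -> M' `<=` A ->
  B `<=` M -> B `<=` M' -> M <> M' ->
  exists N, [/\ hasdeg N (b - 2), M `<=` N, M' `<=` N, N `<=` A &
    forall K, omodule nu K -> M `<=` K -> M' `<=` K -> N `<=` K].
Proof.
move=> hA hB hM hM' MA M'A BM BM' MM'.
have nM'M : ~ (M' `<=` M) by move=> s; apply: MM'; rewrite (hasdeg_eq dv hM hM' s).
have [x [M'x Mx pix]] := exists_pi_step (om hM') hM nM'M.
have hx := hasdeg_addO dv pi0 nupi hM Mx pix.
exists (addO nu M x); split.
- by rewrite (_ : b - 2 = b - 1 - 1) //; lia.
- exact: sub_addO.
- have hB' : hasdeg B (b - 1 + 1) by rewrite subrK.
  rewrite (_ : M' = addO nu B x).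
    by move=> v [y [s [By os ->]]]; exists y, s; split => //; exact: BM.
  apply: (addO_eq hB' hM') => //; first by move=> /BM.
  exact: (pi_mul_colength1 hM' hB').
- by apply: addO_sub => //; [exact: om hA|exact: M'A].
- by move=> K oK MK M'K; apply: addO_sub => //; exact: M'K.
Qed.

(** [A / B] is a plane over the residue field, and the lattices sought are its [q + 1] lines:
    [M0 = B + O u] and the lines through [e + r u], with [r] running over the representatives of the
    residues. *)
Lemma colength2_card A a B q : residue_field_card nu q -> hasdeg A a -> hasdeg B (a + 2) ->
  B `<=` A -> (forall x, A x -> B (pi *: x)) ->
  exists l : seq (set vec), [/\ uniq l, size l = q.+1 &
    forall M, M \in l <-> [/\ hasdeg M (a + 1), B `<=` M & M `<=` A]].
Proof.
move=> [s [ssz sO sinj ssur]] hA hB BA piAB.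
have [|M0 [hM0 BM0 M0A]] := exists_between (n := a + 1) hA hB BA; first lia.
have hB1 : hasdeg B (a + 1 + 1) by rewrite -addrA.
have [u [M0u Bu M0E]] := exists_colength1_elt hM0 hB1 BM0.
have [e [Ae M0e AE]] := exists_colength1_elt hA hM0 M0A.
have [M00 M0D M0Z] := om hM0; have [A0 AD AZ] := om hA; have [B0 BD BZ] := om hB.
pose f r := addO nu B (e + r *: u).
have eru r : intO nu r -> ~ M0 (e + r *: u).
  move=> or h; apply: M0e; rewrite -(addrK (r *: u) e); apply: omoduleB (om hM0) h _ => //.
  exact: M0Z.
have Aeru r : intO nu r -> A (e + r *: u) by move=> or; apply: AD => //; apply/AZ/M0A.
have hf r : intO nu r -> hasdeg (f r) (a + 1).
  move=> or; rewrite (_ : a + 1 = a + 2 - 1); last lia.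
  by apply: (hasdeg_addO dv pi0 nupi hB); [move=> /BM0; exact: eru|apply/piAB/Aeru].
have fA r : intO nu r -> f r `<=` A by move=> or; apply: addO_sub; [exact: om hA|exact: BA|exact: Aeru].
have Bf r : B `<=` f r by exact: sub_addO.
have fmem r : f r (e + r *: u) by apply: mem_addO => //; exact: om hB.
exists (M0 :: [seq f r | r <- s]); split.
- rewrite /= map_inj_in_uniq.
    apply/andP; split; last first.
      apply/(uniqP 0) => i j; rewrite !inE => hi hj ij; apply: sinj => //.
      by rewrite ij subrr; left.
    apply/mapP => -[r /(nthP 0)[i hi <-] M0r].
    by apply: (eru _ (sO i hi)); rewrite M0r; exact: fmem.
  (* If [f r1 = f r2] with [r1 - r2] a unit, this lattice contains [u], hence equals [M0]; but
     [e + r1 u] is not in [M0]. *)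
  move=> r r' /(nthP 0)[i hi <-] /(nthP 0)[j hj <-] ff.
  case: (eqVneq i j) => [-> //|ij]; exfalso; move: ij => /eqP; apply.
  apply: sinj => //; set r1 := nth 0 s i in ff *; set r2 := nth 0 s j in ff *.
  have or1 : intO nu r1 := sO i hi; have or2 : intO nu r2 := sO j hj.
  have [->|r12] := eqVneq (r1 - r2) 0; first by left.
  right; have r12O : intO nu (r1 - r2) by apply: intOD => //; apply: intON.
  have := intO_neq0 r12O r12; rewrite le_eqVlt => /orP[/eqP r0|]; last first.
    by move: (nu _) => t; lia.
  exfalso; have hf1 := hf _ or1.
  have h1 := fmem r1; have := fmem r2; rewrite -ff => h2.
  have ru : f r1 ((r1 - r2) *: u).
    have := omoduleB dv (om hf1) h1 h2.
    by rewrite opprD addrACA subrr add0r -scalerBl.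
  have fu : f r1 u.
    have [_ _ Z] := om hf1; have := Z (r1 - r2)^-1 _ _ ru.
    rewrite scalerA mulVf // scale1r; apply; right; by rewrite nuV // -r0.
  have fM0 : M0 `<=` f r1 by rewrite M0E; apply: addO_sub => //; exact: om hf1.
  by apply: (eru _ or1); rewrite -(hasdeg_eq dv hf1 hM0 fM0).
- by rewrite /= size_map ssz.
- move=> M; rewrite inE; split.
    case/orP => [/eqP -> //|/mapP[r /(nthP 0)[i hi <-] ->]].
    by split; [exact: hf (sO i hi)| exact: Bf | exact: fA (sO i hi)].
  move=> [hM BM MA]; have [//|MM0] := eqVneq M M0; rewrite /=.
  have nMM0 : ~ (M `<=` M0).
    by move=> h; move/eqP: MM0; apply; rewrite (hasdeg_eq dv hM0 hM h).
  (* A vector [m] of [M] outside [M0] generates [A] modulo [M0]. Solving for [e] yields a vector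
     [e - w u] of [M], and [r] is taken to represent [-w]. *)
  move: nMM0 => /existsNP[m /not_implyP[Mm M0m]].
  have Amm : A = addO nu M0 m.
    apply: (addO_eq hM0 hA) => //; [exact: MA|].
    by apply/BM0/piAB/MA.
  have [m0 [t [M0m0 ot eE]]] : addO nu M0 m e by rewrite -Amm.
  have [b0 [w [Bb0 ow m0E]]] : addO nu B u m0 by rewrite -M0E.
  have [_ MD MZ] := om hM.
  have Mew : M (e - w *: u).
    have -> : e - w *: u = b0 + t *: m by rewrite eE m0E addrAC addrK.
    by apply: MD; [exact: BM|exact: MZ].
  have [i [hi wi]] := ssur (- w) (intON dv ow).
  set r := nth 0 s i in wi.
  apply/mapP; exists r; first by apply/(nthP 0); exists i.
  apply: (hasdeg_eq dv hM (hf r (sO i hi))); apply: addO_sub => //; first exact: om hM.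
  (* As [r] and [-w] are congruent modulo [pi] and [pi A] lies in [B], the correction term stays in
     [M]. *)
  have -> : e + r *: u = (e - w *: u) + pi *: ((- (- w - r) / pi) *: u).
    rewrite scalerA mulrCA mulfV // mulr1 opprB opprK scalerDl.
    by rewrite [r *: u + _]addrC addrA subrK.
  apply: MD => //; apply/BM/piAB/M0A/M0Z => //.
  apply: intO_div => //; case: wi => [->|wi]; [by left; rewrite oppr0|].
  have [->|wr0] := eqVneq (- w - r) 0; first by left; rewrite oppr0.
  by right; rewrite nuN // nupi.
Qed.

Lemma pi_pow_sub A a B b : hasdeg A a -> hasdeg B b ->
  exists k : nat, forall x, A x -> B (pi ^+ k *: x).
Proof.
move=> [g [ug -> _]] hB.
have /choice[k hk] : forall j : 'I_d, exists k : nat, B (pi ^+ k *: col j g).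
  by move=> j; exact: (pi_pow_mem dv pi0 nupi _ hB).
have [B0 BD BZ] := om hB.
exists (\sum_j k j)%N => _ [v hv <-].
have -> : g *m v = \sum_j v j 0 *: col j g.
  apply/colP => i; rewrite mxE summxE; apply: eq_bigr => j _.
  by rewrite !mxE mulrC.
rewrite scaler_sumr; apply: (big_ind B) => // j _.
rewrite scalerA mulrC -scalerA; apply: (BZ) => //.
rewrite (bigD1 j) //= exprD mulrC -scalerA; apply: BZ => //.
by right; rewrite nu_exprn // nupi; lia.
Qed.

(* The exchange step behind gallery connectivity: replacing [L] by [M] shrinks
   the lattice needed to contain it together with [L']. *)
Lemma exists_closer L L' S n m : hasdeg L n -> hasdeg L' n -> hasdeg S m ->
  L `<=` S -> L' `<=` S -> L <> L' ->
  exists D M S' m', [/\ hasdeg D (n + 1) /\ D `<=` L, hasdeg M n /\ D `<=` M,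
     hasdeg S' m' /\ S' `<=` S, m < m' /\ M `<=` S' & L' `<=` S'].
Proof.
move=> hL hL' hS LS L'S LL'.
have nLL' : ~ (L `<=` L') by move=> s; apply: LL'; rewrite (hasdeg_eq dv hL' hL s).
have [k hk] := pi_pow_sub hL hL'.
have pk0 : pi ^+ k != 0 by rewrite expf_neq0.
have [i hI] : exists i, hasdeg (L `&` L') i.
  apply: (omodule_between hL (hasdeg_scale dv pk0 hL)).
  - move=> _ [x Lx <-]; split; last exact: hk.
    by have [_ _ Z] := om hL; apply: Z => //; right; rewrite nu_exprn // nupi; lia.
  - by move=> x [].
  - by apply: omoduleI; [exact: om hL|exact: om hL'].
have ni : n < i by apply: (hasdeg_lt hL hI) => [x []//|s]; apply: nLL' => x /s [].
(* [D] has colength one in [L] and still contains the intersection of [L] and [L']; adjoining to it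
   a vector of [L'] will give [M]. *)
have [||D [hD ID DL]] := exists_between (n := n + 1) hL hI; [by move=> x []|lia|].
have nL'D : ~ (L' `<=` D) by move=> s; have [] := hasdeg_sub dv hD hL' s; lia.
have [y [L'y Dy piy]] := exists_pi_step (om hL') hD nL'D.
have := hasdeg_addO dv pi0 nupi hD Dy piy; rewrite addrK => hM.
have L'sum : L' `<=` sumset D L'.
  by move=> x L'x; exists 0, x; rewrite add0r; split => //; case: (om hD).
have Dsum : D `<=` sumset D L'.
  by move=> x Dx; exists x, 0; rewrite addr0; split => //; case: (om hL').
have osum := omodule_sum (om hD) (om hL').
have sumS : sumset D L' `<=` S.
  move=> _ [x [z [Dx L'z ->]]]; have [_ SD _] := om hS.
  by apply: SD; [exact/LS/DL|exact: L'S].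
have [m' hS'] := omodule_between hS hL' L'sum sumS osum.
exists D, (addO nu D y), (sumset D L'), m'; split => //.
  by split => //; exact: sub_addO.
split; last by apply: addO_sub => //; exact: L'sum.
apply: (hasdeg_lt hS hS') => // Ssum.
(* If [D + L'] were all of [S], the modular law would give [L = D + (L & L') = D]. *)
have LD : L `<=` D.
  move=> x Lx; have [z [l [Dz L'l xE]]] := Ssum _ (LS _ Lx).
  have [_ DD _] := om hD; rewrite xE; apply: DD => //; apply: ID; split => //.
  have -> : l = x - z by rewrite xE addrC addKr.
  by apply: (omoduleB dv (om hL)) => //; exact: DL.
by have [] := hasdeg_sub dv hD hL LD; lia.
Qed.

End LatticeIntervals.

(** * Chambers of the building *)

Section AgreeOff.
Variables (d : nat) (T : Type).
Implicit Types x y : int -> T.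

(* Types are represented by integers, which only matter modulo [d]. *)
Definition off1 (i : int) x y := forall k, ~~ (d%:Z %| k - i)%Z -> x k = y k.
Definition off2 (i j : int) x y :=
  forall k, ~~ (d%:Z %| k - i)%Z -> ~~ (d%:Z %| k - j)%Z -> x k = y k.

End AgreeOff.

Lemma dvdz_small (d : nat) (k : int) : (0 < `|k| < d)%N -> (d%:Z %| k)%Z = false.
Proof.
move=> /andP[k0 kd]; apply/negbTE; rewrite dvdzE absz_nat; apply/negP => /dvdn_leq.
by rewrite k0 => /(_ isT); lia.
Qed.

Section Chambers.
Variables (F : fieldType) (nu : F -> int) (d : nat) (pi : F).
Local Notation vec := 'cV[F]_d.
Local Notation hasdeg := (hasdeg nu).
Implicit Types (L A B D M N S : set vec) (x y v : vec) (c : int -> set vec) (i j k l m : int).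

(* The chain is indexed by the valuation of the determinant, so that [c k] is
   the unique lattice of degree [k] in its homothety class. *)
Definition chamber c := [/\ forall k, hasdeg (c k) k, forall k, c (k + 1) `<=` c k
  & forall k, c (k + d%:Z) = scale_set pi (c k)].

Lemma chamber_mono c k l : chamber c -> k <= l -> c l `<=` c k.
Proof.
move=> [_ cS _] kl; rewrite (_ : l = k + `|l - k|%N%:Z); last lia.
elim: `|l - k|%N => [|n IH]; first by rewrite addr0.
rewrite (_ : k + n.+1%:Z = k + n%:Z + 1); last lia.
exact: subset_trans (cS _) IH.
Qed.

Hypothesis pi0 : pi != 0.

Lemma chamber_period c k m : chamber c -> c (k + d%:Z * m) = scale_set (pi ^ m) (c k).
Proof.
move=> [_ _ cP].
have nat_case k' (n : nat) : c (k' + d%:Z * n%:Z) = scale_set (pi ^ n%:Z) (c k').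
  elim: n => [|n IH]; first by rewrite mulr0 addr0 expr0z scale_set1.
  rewrite (_ : k' + _ = k' + d%:Z * n%:Z + d%:Z); last lia.
  by rewrite cP IH scale_setM exprSz.
case: m => n; first exact: nat_case.
have := nat_case (k + d%:Z * Negz n) n.+1.
rewrite (_ : k + d%:Z * Negz n + d%:Z * n.+1%:Z = k); last lia.
move=> ->; rewrite scale_setM NegzE -expfzDr // addNr expr0z scale_set1 //.
Qed.

Lemma chamber_mod c c' k l : chamber c -> chamber c' -> (d%:Z %| k - l)%Z ->
  c l = c' l -> c k = c' k.
Proof.
move=> hc hc' /dvdzP[m e] cl; rewrite (_ : k = l + d%:Z * m); last lia.
by rewrite !chamber_period // cl.
Qed.

Lemma chamber_eq_off1 c c' i : chamber c -> chamber c' -> off1 d i c c' ->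
  c i = c' i -> c = c'.
Proof.
move=> hc hc' o e; apply/funext => k; case: (boolP (d%:Z %| k - i)%Z) => [h|/o //].
exact: (@chamber_mod _ _ _ i).
Qed.

(** A vertex is a homothety class, so every lattice of index congruent to [i] is replaced: [pi^m M]
    is put at [i + m d]. *)
Definition upd c i M k := if (d%:Z %| k - i)%Z then scale_set (pi ^ ((k - i) %/ d%:Z)%Z) M else c k.

Lemma upd_same c i M : upd c i M i = M.
Proof. by rewrite /upd subrr dvdz0 div0z expr0z scale_set1. Qed.

Lemma upd_off1 c i M : off1 d i c (upd c i M).
Proof. by move=> k h; rewrite /upd (negbTE h). Qed.

Hypotheses (dv : discrete_valuation nu) (nupi : nu pi = 1) (d3 : (3 <= d)%N).

Let om L n : hasdeg L n -> omodule nu L. Proof. exact: hasdeg_omodule. Qed.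

Lemma upd_chamber c i M : chamber c -> hasdeg M i -> c (i + 1) `<=` M -> M `<=` c (i - 1) ->
  chamber (upd c i M).
Proof.
move=> hc hM cM Mc; have [cd cS cP] := hc; have d0 : d%:Z != 0 by lia.
split=> k; rewrite /upd.
- case: ifP => // /dvdzP[m e]; rewrite e mulzK //.
  have := hasdeg_scale dv (_ : pi ^ m != 0) hM; rewrite nu_exprz // nupi.
  by move=> /(_ (expfz_neq0 _ pi0)); rewrite mulr1 (_ : i + d%:Z * m = k) //; lia.
- case: ifP => [/dvdzP[m e]|_].
    rewrite ifF; last first.
      have k1 : k - i = -1 + m * d%:Z by lia.
      by rewrite k1 rpredDr ?dvdz_mull // dvdz_small //; lia.
    rewrite (_ : k = i - 1 + d%:Z * m); last lia.
    rewrite chamber_period // (_ : i - 1 + d%:Z * m + 1 - i = m * d%:Z); last lia.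
    by rewrite mulzK //; exact: scale_setS.
  case: ifP => [/dvdzP[m e]|_]; last exact: cS.
  rewrite (_ : k + 1 = i + 1 + d%:Z * m); last lia.
  by rewrite chamber_period // e mulzK //; exact: scale_setS.
- rewrite (_ : k + d%:Z - i = k - i + d%:Z); last lia.
  rewrite rpredDr ?dvdzz //; case: ifP => [/dvdzP[m e]|_]; last exact: cP.
  rewrite e (_ : m * d%:Z + d%:Z = (1 + m) * d%:Z); last lia.
  by rewrite !mulzK // scale_setM (expfzDr _ _ pi0) // expr1z.
Qed.

Lemma exists_flag (n : nat) A a B : hasdeg A a -> hasdeg B (a + n%:Z) -> B `<=` A ->
  exists t : nat -> set vec, [/\ t 0%N = A, t n = B,
    forall j : nat, (j <= n)%N -> hasdeg (t j) (a + j%:Z) & forall j : nat, (j < n)%N -> t j.+1 `<=` t j].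
Proof.
elim: n a A => [|n IH] a A hA hB BA.
  rewrite addr0 in hB; have AB := hasdeg_eq dv hA hB BA.
  by exists (fun=> A); split => // j; rewrite leqn0 => /eqP ->; rewrite addr0.
have [|A' [hA' BA' A'A]] := exists_between dv pi0 nupi (n := a + 1) hA hB BA; first lia.
have hB' : hasdeg B (a + 1 + n%:Z) by rewrite (_ : a + 1 + n%:Z = a + n.+1%:Z) //; lia.
have [t [t0 tn td tS]] := IH _ _ hA' hB' BA'.
exists (fun j => if j is j'.+1 then t j' else A); split => //.
  case=> [|j] jn; first by rewrite addr0.
  by rewrite (_ : a + j.+1%:Z = a + 1 + j%:Z); [exact: td | lia].
by case=> [|j] jn; [rewrite t0 | exact: tS].
Qed.

(** The flag is continued periodically, with [pi^m t_j] at [a + j + m d]; the last hypothesis joins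
    the end of a period to the start of the next. *)
Lemma exists_chamber_flag a (t : nat -> set vec) :
  (forall j : nat, (j < d)%N -> hasdeg (t j) (a + j%:Z)) ->
  (forall j : nat, (j.+1 < d)%N -> t j.+1 `<=` t j) -> scale_set pi (t 0%N) `<=` t d.-1 ->
  exists c, chamber c /\ forall j : nat, (j < d)%N -> c (a + j%:Z) = t j.
Proof.
move=> td tS tE; have d0 : d%:Z != 0 by lia.
pose c k := scale_set (pi ^ ((k - a) %/ d%:Z)%Z) (t `|((k - a) %% d%:Z)%Z|%N).
have cE m (j : nat) : (j < d)%N -> c (a + j%:Z + m * d%:Z) = scale_set (pi ^ m) (t j).
  move=> jd; rewrite /c (_ : a + j%:Z + m * d%:Z - a = m * d%:Z + j%:Z); last lia.
  have jb : 0 <= j%:Z < `|d%:Z| by rewrite ger0_norm //= ltz_nat.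
  by rewrite divzMDl // modzMDl divz_small // modz_small // addr0.
have kE k : exists m (j : nat), (j < d)%N /\ k = a + j%:Z + m * d%:Z.
  have m0 := modz_ge0 (k - a) d0; have ml := ltz_pmod (k - a) (_ : 0 < d%:Z).
  exists ((k - a) %/ d%:Z)%Z, `|((k - a) %% d%:Z)%Z|%N.
  have := divz_eq (k - a) d%:Z; have {}ml := ml ltac:(lia); move: m0 ml.
  move: ((k - a) %/ d%:Z)%Z ((k - a) %% d%:Z)%Z => u r r0 rd e; split; first lia.
  by rewrite (_ : `|r|%N%:Z = r); lia.
exists c; split; last first.
  by move=> j jd; have := cE 0 j jd; rewrite mul0r addr0 => ->; rewrite expr0z scale_set1.
split=> k; have [m [j [jd ->]]] := kE k.
- rewrite cE //; have := hasdeg_scale dv (expfz_neq0 m pi0) (td j jd).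
  by rewrite nu_exprz // nupi mulr1 mulrC.
- rewrite cE //; case: (ltnP j.+1 d) => jd1.
    rewrite (_ : _ + 1 = a + j.+1%:Z + m * d%:Z); last lia.
    by rewrite cE //; apply/scale_setS/tS.
  rewrite (_ : _ + 1 = a + 0%N%:Z + (1 + m) * d%:Z); last lia.
  rewrite cE; last lia.
  rewrite (expfzDr _ _ pi0) // expr1z mulrC -scale_setM; apply: scale_setS.
  by rewrite (_ : j = d.-1); [exact: tE | lia].
- rewrite (_ : _ + d%:Z = a + j%:Z + (1 + m) * d%:Z); last lia.
  by rewrite !cE // scale_setM (expfzDr _ _ pi0) // expr1z.
Qed.

(** A flag from [p n] down to [pi (p 0)] completes the prescribed lattices to one period. *)
Lemma exists_chamber_prefix a (n : nat) (p : nat -> set vec) : (n < d)%N ->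
  (forall j : nat, (j <= n)%N -> hasdeg (p j) (a + j%:Z)) ->
  (forall j : nat, (j < n)%N -> p j.+1 `<=` p j) -> scale_set pi (p 0%N) `<=` p n ->
  exists c, chamber c /\ forall j : nat, (j <= n)%N -> c (a + j%:Z) = p j.
Proof.
move=> nd pd pS pE.
have hE : hasdeg (scale_set pi (p 0%N)) (a + n%:Z + (d - n)%N%:Z).
  have := hasdeg_scale dv pi0 (pd 0%N isT).
  by rewrite nupi mulr1 (_ : a + 0%N%:Z + d%:Z = a + n%:Z + (d - n)%N%:Z) //; lia.
have [t [t0 tn td tS]] := exists_flag (pd n (leqnn n)) hE pE.
pose u (j : nat) := if (j <= n)%N then p j else t (j - n)%N.
have un : u n = t 0%N by rewrite /u leqnn t0.
have ut (j : nat) : (n <= j)%N -> u j = t (j - n)%N.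
  by rewrite leq_eqVlt => /orP[/eqP <-|h]; [rewrite un subnn | rewrite /u leqNgt h].
have [|||c [hc cu]] := @exists_chamber_flag a u.
- move=> j jd; case: (leqP j n) => jn; first by rewrite /u jn; exact: pd.
  rewrite ut ?(ltnW jn) // (_ : a + j%:Z = a + n%:Z + (j - n)%N%:Z); last lia.
  by apply: td; lia.
- move=> j jd; case: (ltnP j n) => jn; first by rewrite /u jn ltnW //; exact: pS.
  rewrite !ut ?leqW // subSn //; apply: tS; lia.
- rewrite (ut d.-1); last lia.
  rewrite /u /= -tn (_ : (d - n = (d.-1 - n).+1)%N); last lia.
  by apply: tS; lia.
by exists c; split => // j jn; rewrite cu ?/u ?jn //; exact: leq_ltn_trans nd.
Qed.

Lemma exists_chamber L a : hasdeg L a -> exists c, chamber c /\ c a = L.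
Proof.
move=> hL; have [||||c [hc /(_ 0%N isT)]] := @exists_chamber_prefix a 0 (fun=> L).
- by lia.
- by move=> j; rewrite leqn0 => /eqP ->; rewrite addr0.
- by [].
- by move=> _ [x Lx <-]; apply: (omodule_pi nupi (om hL)).
by rewrite addr0 => cL; exists c.
Qed.

(** * Gallery connectivity of the building *)

Section Galleries.
Variables (V : Type) (Phi : (int -> set vec) -> V).
(** Instead of paths, connectivity is expressed by an arbitrary function constant on adjacent
    chambers. *)
Hypothesis PhiP : forall i c c', chamber c -> chamber c' -> off1 d i c c' -> Phi c = Phi c'.

(** Induction on [d - n]. If the chambers differ at [n + 1], the two lattices there meet in [D], of
    degree [n + 2]. A chamber through [c 0, ..., c (n + 1), D] shares more with [c], and exchanging
    its [c (n + 1)] for [c' (n + 1)] gives an adjacent one sharing more with [c']. *)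
Lemma gallery_share (n : nat) c c' : (n.+2 <= d)%N -> chamber c -> chamber c' ->
  (forall j : nat, (j <= n)%N -> c j%:Z = c' j%:Z) -> Phi c = Phi c'.
Proof.
have [r hr] : exists r : nat, (d - n)%N = r by eexists.
elim: r n hr c c' => [|r IH] n hr c c' nd hc hc' cc'; first lia.
(* Agreeing in degrees [0] to [d - 2], the chambers can differ in type [d - 1] only. *)
case: (eqVneq n.+2 d) => [nd2|nd2].
  apply: (@PhiP n.+1%:Z) => // k kn.
  have d0 : d%:Z != 0 by lia.
  have m0 := modz_ge0 k d0; have ml := ltz_pmod k (_ : 0 < d%:Z).
  have kE := divz_eq k d%:Z.
  apply: (@chamber_mod _ _ _ (k %% d%:Z)%Z) => //.
    by rewrite {1}kE addrK dvdz_mull.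
  have {}ml := ml ltac:(lia).
  case: (eqVneq (k %% d%:Z)%Z n.+1%:Z) => [e|e].
    by move: kn; rewrite {1}kE e addrK dvdz_mull.
  rewrite (_ : (k %% d%:Z)%Z = `|(k %% d%:Z)%Z|%N%:Z); last lia.
  by apply: cc'; lia.
have IH' := IH n.+1 ltac:(lia).
case: (pselect (c n.+1%:Z = c' n.+1%:Z)) => [e|ne].
  apply: IH' => //; first lia.
  by move=> j; rewrite leq_eqVlt => /orP[/eqP -> //|]; exact: cc'.
have [cd cS cP] := hc; have [cd' cS' cP'] := hc'.
set D := c n.+1%:Z `&` c' n.+1%:Z.
have cn : c n%:Z = c' n%:Z by apply: cc'.
have cpi : c d%:Z = c' d%:Z by rewrite -[d%:Z]add0r cP cP' cc'.
have n1 : n.+1%:Z = n%:Z + 1 by lia.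
have hD : hasdeg D (n%:Z + 2).
  apply: (@hasdeg_meet _ _ _ _ dv pi0 nupi (c n%:Z) _ (c d%:Z) d%:Z) => //.
  - by rewrite -n1.
  - by rewrite -n1.
  - by apply: chamber_mono => //; lia.
  - by rewrite cn; apply: chamber_mono => //; lia.
  - by apply: chamber_mono => //; lia.
  - by rewrite cpi; apply: chamber_mono => //; lia.
pose p (j : nat) := if (j <= n.+1)%N then c j%:Z else D.
have [||||c1 [hc1 c1p]] := @exists_chamber_prefix 0 n.+2 p.
- by lia.
- move=> j jn; rewrite add0r /p; case: ifP => [_|jn'] //.
  by rewrite (_ : j%:Z = n%:Z + 2) //; lia.
- move=> j jn; rewrite /p (_ : (j <= n.+1)%N) //; case: ifP => jn'.
    by apply: chamber_mono => //; lia.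
  by rewrite (_ : j = n.+1); [move=> x [] | lia].
- rewrite /p leq0n ltnn -cP add0r => x cdx; split; last rewrite cpi in cdx.
    by apply: chamber_mono cdx => //; lia.
  by apply: chamber_mono cdx => //; lia.
have c1E (j : nat) : (j <= n.+1)%N -> c1 j%:Z = c j%:Z.
  by move=> jn; have := c1p j ltac:(lia); rewrite add0r /p jn.
have c1D : c1 (n.+1%:Z + 1) = D.
  have := c1p n.+2 ltac:(lia); rewrite add0r /p ltnn => <-; congr c1; lia.
have hc2 : chamber (upd c1 n.+1%:Z (c' n.+1%:Z)).
  apply: upd_chamber => //; first by rewrite c1D => x [].
  rewrite (_ : n.+1%:Z - 1 = n%:Z) ?c1E ?cn //; last lia.
  by apply: chamber_mono => //; lia.
rewrite (IH' c c1) //; [|lia|by move=> j jn; rewrite c1E].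
rewrite (PhiP hc1 hc2 (@upd_off1 _ _ _)).
apply: IH' => //; first lia.
move=> j; rewrite leq_eqVlt => /orP[/eqP ->|jn]; first by rewrite upd_same.
rewrite -(@upd_off1 c1 n.+1%:Z) ?c1E ?cc' //; first lia.
by rewrite dvdz_small //; lia.
Qed.

(** Induction on [|m|], with [m] the degree of a lattice [S] containing [c0 0] and [c' 0]. The
    exchange step replaces [c0 0] by [M] and [S] by a smaller lattice, until the lattices at [0]
    coincide and [gallery_share] applies. *)
Lemma gallery_connected c c' : chamber c -> chamber c' -> Phi c = Phi c'.
Proof.
have d2 : (2 <= d)%N by lia.
move=> + hc'; have [cd' _ _] := hc'.
suff conn (r : nat) c0 S m : chamber c0 -> hasdeg S m -> c0 0 `<=` S -> c' 0 `<=` S ->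
    (`|m| <= r)%N -> Phi c0 = Phi c'.
  move=> hc; have [cd _ _] := hc.
  have [k hk] := pi_pow_sub dv pi0 nupi (cd' 0) (cd 0).
  have pk0 : (pi ^+ k)^-1 != 0 by rewrite invr_eq0 expf_neq0.
  have hS := hasdeg_scale dv pk0 (cd 0).
  apply: (conn _ c _ _ hc hS) => // x cx; apply/mem_scale => //; rewrite invrK; last exact: hk.
  by have [_ _ Z] := om (cd 0); apply: Z => //; right; rewrite nu_exprn // nupi; lia.
elim: r c0 S m => [|r IH] c0 S m hc0 hS c0S c'S mr; have [cd0 _ _] := hc0.
all: have [m0 _] := hasdeg_sub dv hS (cd0 0) c0S.
all: case: (pselect (c0 0 = c' 0)) => [e|ne];
  first by apply: (@gallery_share 0) => // j; rewrite leqn0 => /eqP ->.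
all: have [D [M [S' [m' [[hD DL] [hM DM] [hS' S'S] [mm' MS'] L'S']]]]] :=
  exists_closer dv pi0 nupi (cd0 0) (cd' 0) hS c0S c'S ne.
  (* For [r = 0] the lattice [S'] would have positive degree and yet contain [c' 0], of degree
     [0]. *)
  by have [] := hasdeg_sub dv hS' (cd' 0) L'S'; lia.
have m'0 : m' <= 0 by have [] := hasdeg_sub dv hS' (cd' 0) L'S'.
have m'r : (`|m'| <= r)%N by lia.
case: (pselect (c0 0 = M)) => [LM|LM].
  by apply: (IH _ _ _ hc0 hS') => //; rewrite LM.
have MS := subset_trans MS' S'S.
(* [c0 0] and [M] have colength one in their sum [U] and meet in [D], so a chamber through
   [U, c0 0, D] is adjacent to one through [U, M, D]. *)
have [||U [hU LU MU _ _]] :=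
  hasdeg_join dv pi0 nupi (M := c0 0) (M' := M) hS hD _ _ c0S MS DL DM LM.
- by rewrite addrK; exact: cd0.
- by rewrite addrK.
rewrite (_ : 0 + 1 - 2 = -1) // in hU.
have hL : hasdeg (c0 0) (-1 + 1) by [].
have hM' : hasdeg M (-1 + 1) by [].
have DE : c0 0 `&` M = D.
  have h := hasdeg_meet dv pi0 nupi hU hD hL hM' LU MU DL DM LM.
  by apply: (hasdeg_eq dv h hD) => x Dx; split; [exact: DL|exact: DM].
pose p (j : nat) := nth D [:: U; c0 0] j.
have [||||c1 [hc1 c1p]] := @exists_chamber_prefix (-1) 2 p.
- by [].
- by case=> [|[|[|]]].
- by case=> [|[|]].
- move=> _ [x Ux <-]; rewrite /p /= -DE.
  split; first exact: (pi_mul_colength1 dv pi0 nupi hU hL).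
  exact: (pi_mul_colength1 dv pi0 nupi hU hM').
have c1U : c1 (0 - 1) = U by exact: (c1p 0%N isT).
have c1L : c1 0 = c0 0 by exact: (c1p 1%N isT).
have c1D : c1 (0 + 1) = D by exact: (c1p 2%N isT).
have hc2 : chamber (upd c1 0 M).
  by apply: upd_chamber => //; rewrite ?c1D ?c1U.
rewrite (@gallery_share 0 c0 c1) //; last by move=> j; rewrite leqn0 => /eqP ->.
rewrite (PhiP hc1 hc2 (@upd_off1 _ _ _)).
by apply: (IH _ _ _ hc2 hS') => //; rewrite upd_same.
Qed.

End Galleries.
End Chambers.

(** * Chambers of the quotient *)

Section Off.
Variables (d : nat) (T : Type).
Implicit Types (x y z : int -> T) (i j : int).

Lemma off1_sym i x y : off1 d i x y -> off1 d i y x.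
Proof. by move=> h k ki; rewrite h. Qed.

Lemma off1_trans i x y z : off1 d i x y -> off1 d i y z -> off1 d i x z.
Proof. by move=> h h' k ki; rewrite h // h'. Qed.

Lemma off2C i j x y : off2 d i j x y -> off2 d j i x y.
Proof. by move=> h k ki kj; rewrite h. Qed.

Lemma off1_off2 i j x y : off1 d i x y -> off2 d i j x y.
Proof. by move=> h k ki kj; rewrite h. Qed.

Lemma off2_gallery i j x y y' z : off1 d i x y -> off1 d j y y' -> off1 d i y' z -> off2 d i j x z.
Proof. by move=> h1 h2 h3 k ki kj; rewrite h1 // h2 // h3. Qed.

Lemma dvdz_sub_mod (k j j' : int) : (d%:Z %| j - j')%Z -> (d%:Z %| k - j)%Z = (d%:Z %| k - j')%Z.
Proof. by move=> h; rewrite -[in RHS](subrK j k) -addrA (rpredDr _ h). Qed.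

Lemma off1_mod (j j' : int) x y : (d%:Z %| j - j')%Z -> off1 d j x y -> off1 d j' x y.
Proof. by move=> jj h k kj; apply: h; rewrite (dvdz_sub_mod _ jj). Qed.

Lemma off2_mod i (j j' : int) x y : (d%:Z %| j - j')%Z -> off2 d i j x y -> off2 d i j' x y.
Proof. by move=> jj h k ki kj; apply: h => //; rewrite (dvdz_sub_mod _ jj). Qed.

Lemma off1_eq i j x y : ~~ (d%:Z %| i - j)%Z -> off1 d i x y -> off1 d j x y -> x = y.
Proof.
move=> ij oi oj; apply/funext => k; case: (boolP (d%:Z %| k - i)%Z) => [ki|/oi //].
apply: oj; apply: contra ij => kj.
have -> : i - j = (k - j) - (k - i) by lia.
exact: rpredB.
Qed.

End Off.

(** * Lifting chambers of [X], and its rank two residues *)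

Section Quotient.
Variables (F : fieldType) (nu : F -> int) (d : nat) (pi : F) (Gam : set 'M[F]_d).
Hypotheses (dv : discrete_valuation nu) (pi0 : pi != 0) (nupi : nu pi = 1).
Hypothesis d3 : (3 <= d)%N.
Hypotheses (GamP : PGL_subgroup Gam) (Gam_inj : inj_radius_ge2 nu pi Gam).
Local Notation vec := 'cV[F]_d.
Local Notation hasdeg := (hasdeg nu).
Local Notation chamber := (chamber nu pi).
Local Notation orbit := (Defs.orbit Gam).
Implicit Types (L A B D M N S : set vec) (c e : int -> set vec) (i j k l : int).
Implicit Types (x y z : int -> set (set vec)).

Let Gam_unit g : Gam g -> g \in unitmx. Proof. by case: GamP => h _ _ _; exact: h. Qed.
Let GamM g h : Gam g -> Gam h -> Gam (g *m h). Proof. by case: GamP => _ _ h' _; exact: h'. Qed.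
Let GamV g : Gam g -> Gam (invmx g). Proof. by case: GamP => _ _ _; exact. Qed.
Let Gamc (a : F) : a != 0 -> Gam a%:M. Proof. by case: GamP => _ h _ _; exact: h. Qed.

Lemma orbit_act g L : Gam g -> orbit (act g L) = orbit L.
Proof.
move=> hg; apply/seteqP; split=> _ [h hh <-].
  by exists (h *m g); rewrite ?actM //; exact: GamM.
exists (h *m invmx g); first by apply: GamM => //; exact: GamV.
by rewrite -actM actK // Gam_unit.
Qed.

Lemma orbit_scale (a : F) L : a != 0 -> orbit (scale_set a L) = orbit L.
Proof. by move=> a0; rewrite -act_scalar orbit_act //; exact: Gamc. Qed.

Lemma orbit_eq L L' : orbit L = orbit L' -> exists g, Gam g /\ L' = act g L.
Proof.
have : orbit L' L' by exists 1%:M; [apply: Gamc; exact: oner_neq0 | exact: act1].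
by move=> + e; rewrite -e => -[g hg <-]; exists g.
Qed.

(** A chamber of [X] is encoded as the sequence of the orbits of a lattice chain. The integer index
    keeps the type of each vertex, and only its class modulo [d] matters ([quot_mod]). *)
Definition quot c k := orbit (c k).
Definition Xchamber := [set quot c | c in chamber].

Lemma quot_mod c k l : chamber c -> (d%:Z %| k - l)%Z -> quot c k = quot c l.
Proof.
move=> hc /dvdzP[m e]; rewrite /quot (_ : k = l + d%:Z * m); last lia.
by rewrite (chamber_period pi0 _ _ hc) orbit_scale // expfz_neq0.
Qed.

Lemma same_vertex_mod c k l : chamber c -> same_vertex (c k) (c l) -> (d%:Z %| l - k)%Z.
Proof.
move=> [cd _ _] [a [a0 e]]; have := hasdeg_scale dv a0 (cd k); rewrite -e => h.
have -> : l - k = d%:Z * nu a by rewrite (hasdeg_uniq dv (cd l) h) addrC addKr.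
by rewrite dvdz_mulr.
Qed.

Lemma chamber_proper c k l : chamber c -> k < l -> c l `<` c k.
Proof.
move=> hc kl; have [cd _ _] := hc; split; first exact: (chamber_mono hc (ltW kl)).
by move=> s; have [] := hasdeg_sub dv (cd l) (cd k) s; lia.
Qed.

(** The degree modulo [d] separates the homothety classes within one period. Two indices give the
    edges of a chamber, a full period the chamber itself. *)
Lemma chamber_face c k (s : seq int) : chamber c -> path <%R k s -> last k s < k + d%:Z ->
  is_face nu pi [seq c l | l <- k :: s].
Proof.
move=> hc ks lk; have [cd cS cP] := hc.
have In_map L (r : seq int) : List.In L [seq c l | l <- r] -> exists l, L = c l.
  elim: r => // l r IH [<-|]; first by exists l.
  exact: IH.
split.
- by move=> L /In_map[l ->]; exact: hasdeg_lattice (cd l).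
- move=> i j; rewrite size_map => hi hj; rewrite !(nth_map 0) // => /(same_vertex_mod hc).
  have srt : sorted <%R (k :: s) by [].
  have bound n : (n < size (k :: s))%N -> k <= nth 0 (k :: s) n < k + d%:Z.
    move=> hn; have le_tr : transitive (<=%R : rel int) by exact: le_trans.
    have srt' : sorted <=%R (k :: s) by apply: (sub_sorted ltW) srt.
    have nth_le := sorted_leq_nth le_tr lexx 0 srt'.
    apply/andP; split; first by apply: (nth_le 0%N n).
    by apply: le_lt_trans lk; rewrite (last_nth 0); apply: nth_le; rewrite ?inE.
  have := bound i hi; have := bound j hj.
  have [a ea] : exists a, nth 0 (k :: s) i = a by eexists.
  have [b eb] : exists b, nth 0 (k :: s) j = b by eexists.
  rewrite ea eb => ja ia dab.
  have ab : a = b.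
    apply/eqP; case: (ltrgtP a b) => // h; move: dab; rewrite dvdz_small //; lia.
  have lt_tr : transitive (<%R : rel int) by exact: lt_trans.
  have := sorted_uniq lt_tr (@ltxx _ _) srt => /(uniqP 0); apply; rewrite ?inE //.
  by rewrite ea eb.
- exists [seq c l | l <- k :: s]; split => //.
  + split; last first.
      by rewrite last_map -cP; exact: chamber_proper.
    elim: s k ks {lk} => //= l s IH k /andP[kl ls]; split; first exact: chamber_proper.
    exact: IH.
  + by move=> L hL; exists L; split => //; exists 1; rewrite oner_neq0 scale_set1.
  + by move=> L hL; exists L; split => //; exists 1; rewrite oner_neq0 scale_set1.
Qed.

(* [c j] and [c' j] lie in the star of the vertex [c k], on which the covering
   map is injective. *)
Lemma lift_unique c c' k j : chamber c -> chamber c' -> c k = c' k ->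
  quot c j = quot c' j -> c j = c' j.
Proof.
move=> hc hc' ck oj; have [cd _ _] := hc; have [cd' _ _] := hc'.
have d0 : d%:Z != 0 by lia.
have m0 := modz_ge0 (j - k) d0; have ml := ltz_pmod (j - k) (_ : 0 < d%:Z).
have {}ml := ml ltac:(lia).
have jj : (d%:Z %| j - (k + ((j - k) %% d%:Z)%Z))%Z.
  by rewrite opprD addrA {1}(divz_eq (j - k) d%:Z) addrK dvdz_mull.
apply: (chamber_mod pi0 hc hc' jj).
move: oj; rewrite (quot_mod hc jj) (quot_mod hc' jj).
move: m0 ml; move: ((j - k) %% d%:Z)%Z => r r0 rd orr {jj}.
case: (eqVneq r 0) => [->|rn0]; first by rewrite addr0.
have rp : 0 < r by rewrite lt_neqAle eq_sym rn0.
have adj e : chamber e -> adjacent nu pi (e k) (e (k + r)).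
  move=> he; apply: (@chamber_face e k [:: k + r]) => //=; last by rewrite ltrD2l.
  by rewrite andbT ltrDl.
have [g [hg e]] := orbit_eq orr.
have := Gam_inj (hasdeg_lattice (cd k)) (hasdeg_lattice (cd (k + r)))
  (hasdeg_lattice (cd' (k + r))) (or_intror (or_introl (adj c hc))).
rewrite [X in dist_le2 _ _ X _]ck => /(_ (or_intror (or_introl (adj c' hc')))).
move=> /(_ (ex_intro _ g (conj hg e))) [a [a0 ea]].
by rewrite (hasdeg_scale_eq dv a0 (cd _) (cd' _)) //; lia.
Qed.

Lemma act_chamber c g : chamber c -> g \in unitmx -> nu (\det g) = 0 ->
  chamber (fun k => act g (c k)).
Proof.
move=> [cd cS cP] ug g0; split=> k.
- by have := hasdeg_act dv ug (cd k); rewrite g0 addr0.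
- exact/actS/cS.
- by rewrite cP act_scale.
Qed.

(** Translate a lift of [y] by an element of [Gam] so that it passes through [c k]. The degrees at
    [k] force the determinant to have valuation zero, so the indexing is kept, and [lift_unique]
    gives the other agreements. *)
Lemma lift_agree c y k : chamber c -> Xchamber y -> quot c k = y k ->
  exists e, [/\ chamber e, quot e = y & forall j, quot c j = y j -> e j = c j].
Proof.
move=> hc [c' hc' <-] ok; have [cd _ _] := hc; have [cd' _ _] := hc'.
have [g [hg e]] := orbit_eq (esym ok); have ug := Gam_unit hg.
have g0 : nu (\det g) = 0.
  have := hasdeg_act dv ug (cd' k); rewrite -e => h.
  by apply: (@addrI _ k); rewrite addr0 (hasdeg_uniq dv h (cd k)).
have he := act_chamber hc' ug g0.
have oe : quot (fun l => act g (c' l)) = quot c'.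
  by apply/funext => l; rewrite /quot orbit_act.
exists (fun l => act g (c' l)); split => // j oj.
by apply: (@lift_unique (fun l => act g (c' l)) c k j he hc); rewrite ?oe -?e.
Qed.

Lemma Xchamber_mod x k l : Xchamber x -> (d%:Z %| k - l)%Z -> x k = x l.
Proof. by move=> [c hc <-]; exact: quot_mod. Qed.

Let dvd1 : (d%:Z %| 1)%Z = false. Proof. by rewrite dvdz_small //; lia. Qed.
Let dvdN1 : (d%:Z %| -1)%Z = false. Proof. by rewrite dvdz_small //; lia. Qed.
Let dvd2 : (d%:Z %| 2)%Z = false. Proof. by rewrite dvdz_small //; lia. Qed.
Let dvdN2 : (d%:Z %| -2)%Z = false. Proof. by rewrite dvdz_small //; lia. Qed.

(** A lift of [y] through [c (i + 1)] agrees with [c] in all types but [i], so adjacency in [X]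
    comes from adjacency in the building. *)
Lemma lift_off1 c y i : chamber c -> Xchamber y -> off1 d i (quot c) y ->
  exists M, [/\ hasdeg M i, c (i + 1) `<=` M, M `<=` c (i - 1), chamber (upd pi c i M)
    & y = quot (upd pi c i M)].
Proof.
move=> hc hy o.
have i1 : ~~ (d%:Z %| i + 1 - i)%Z by rewrite addrC addKr dvd1.
have i2 : ~~ (d%:Z %| i - 1 - i)%Z by rewrite addrC addKr dvdN1.
have [e [he ey ec]] := lift_agree hc hy (o _ i1).
have [ed _ _] := he.
have s1 : c (i + 1) `<=` e i by rewrite -(ec _ (o _ i1)); apply: (chamber_mono he); lia.
have s2 : e i `<=` c (i - 1) by rewrite -(ec _ (o _ i2)); apply: (chamber_mono he); lia.
have hu : chamber (upd pi c i (e i)) by apply: (upd_chamber pi0 dv nupi d3).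
exists (e i); split => //; rewrite -ey; congr quot.
apply: (chamber_eq_off1 pi0 he hu (i := i)); last by rewrite upd_same.
by move=> k ki; rewrite -upd_off1 // (ec _ (o _ ki)).
Qed.

(** Lifting identifies the class with the lattices between [c (i + 1)] and [c (i - 1)]; distinct
    ones stay distinct in [X] by [lift_unique] at [i + 1]. *)
Lemma Xchamber_class_card q x i : residue_field_card nu q -> Xchamber x ->
  exists l : seq (int -> set (set vec)), [/\ uniq l, size l = q.+1 &
    forall y, y \in l <-> Xchamber y /\ off1 d i x y].
Proof.
move=> hq [c hc <-]; have [cd cS cP] := hc.
have [|||l [ul sl ml]] := colength2_card dv pi0 nupi (A := c (i - 1)) (a := i - 1)
   (B := c (i + 1)) hq (cd _).
- by rewrite (_ : i - 1 + 2 = i + 1) //; lia.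
- by apply: (chamber_mono hc); lia.
(* [pi c (i - 1)] is [c (i - 1 + d)], which lies in [c (i + 1)] because [d >= 2]. *)
- move=> v Ax; apply: (chamber_mono hc (k := i + 1) (l := i - 1 + d%:Z)); first lia.
  by rewrite cP; exists v.
have hM M : M \in l -> chamber (upd pi c i M).
  move=> /ml[hM BM MA]; apply: (upd_chamber pi0 dv nupi d3) => //.
  by rewrite subrK in hM.
exists [seq quot (upd pi c i M) | M <- l]; split.
- rewrite map_inj_in_uniq // => M M' Ml Ml' e.
  have i1 : ~~ (d%:Z %| i + 1 - i)%Z by rewrite addrC addKr dvd1.
  have := @lift_unique _ _ (i + 1) i (hM _ Ml) (hM _ Ml'); rewrite !upd_same; apply.
    by rewrite -!upd_off1.
  by rewrite e.
- by rewrite size_map.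
- move=> y; split.
    move=> /mapP[M Ml ->]; split; first by exists (upd pi c i M) => //; exact: hM.
    by move=> k ki; rewrite /quot -upd_off1.
  move=> [hy o]; have [M [Md s1 s2 hu ->]] := lift_off1 hc hy o.
  by apply: map_f; apply/ml; rewrite subrK.
Qed.

Lemma lift_off2 x z i j k : Xchamber x -> Xchamber z -> off2 d i j x z ->
  ~~ (d%:Z %| k - i)%Z -> ~~ (d%:Z %| k - j)%Z ->
  exists c c', [/\ chamber c, chamber c', quot c = x, quot c' = z & off2 d i j c c'].
Proof.
move=> [c hc <-] hz o ki kj; have [c' [hc' oc' cc']] := lift_agree hc hz (o k ki kj).
by exists c, c'; split => // m mi mj; rewrite cc' // o.
Qed.

Lemma upd_mod c c' i k : chamber c' -> chamber (upd pi c i (c' i)) -> (d%:Z %| k - i)%Z ->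
  upd pi c i (c' i) k = c' k.
Proof. by move=> hc' hu ki; apply: (chamber_mod pi0 hu hc' ki); rewrite upd_same. Qed.

(** The types [i - 1] and [i + 1] differ from [j], so compatible lifts of [x] and [z] agree there,
    and the lattice of [z] at [i] fits into the lift of [x]. *)
Lemma Xchamber_commute x z i j : Xchamber x -> Xchamber z -> off2 d i j x z ->
  ~~ (d%:Z %| j - i)%Z -> ~~ (d%:Z %| j - i - 1)%Z -> ~~ (d%:Z %| j - i + 1)%Z ->
  exists y, [/\ Xchamber y, off1 d i x y & off1 d j y z].
Proof.
move=> hx hz o ij ij1 ij2.
have i1i : ~~ (d%:Z %| i + 1 - i)%Z by rewrite addrC addKr dvd1.
have i1j : ~~ (d%:Z %| i + 1 - j)%Z.
  by rewrite -rpredN (_ : - (i + 1 - j) = j - i - 1) //; lia.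
have i2i : ~~ (d%:Z %| i - 1 - i)%Z by rewrite addrC addKr dvdN1.
have i2j : ~~ (d%:Z %| i - 1 - j)%Z.
  by rewrite -rpredN (_ : - (i - 1 - j) = j - i + 1) //; lia.
have [c [c' [hc hc' <- <- oc]]] := lift_off2 hx hz o i1i i1j; have [cd' _ _] := hc'.
have hu : chamber (upd pi c i (c' i)).
  apply: (upd_chamber pi0 dv nupi d3) => //; rewrite oc //; apply: (chamber_mono hc'); lia.
exists (quot (upd pi c i (c' i))); split; first by exists (upd pi c i (c' i)).
  by move=> k ki; rewrite /quot -upd_off1.
move=> k kj; rewrite /quot; case: (boolP (d%:Z %| k - i)%Z) => ki.
  by rewrite (upd_mod hc' hu ki).
by rewrite -upd_off1 // oc.
Qed.

(* The residue of type [{i, i + 1}] is a projective plane over the residue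
   field: two distinct lines meet in one point and two distinct points span one
   line. *)
Lemma residue_plane c c' i j : chamber c -> chamber c' -> j = i + 1 \/ j = i - 1 ->
  off2 d i j c c' -> c j <> c' j ->
  exists M, [/\ hasdeg M i, c (i + 1) `<=` M /\ M `<=` c (i - 1),
    c' (i + 1) `<=` M /\ M `<=` c' (i - 1) &
    forall M', hasdeg M' i -> c (i + 1) `<=` M' /\ M' `<=` c (i - 1) ->
      c' (i + 1) `<=` M' /\ M' `<=` c' (i - 1) -> M = M'].
Proof.
move=> hc hc' ij o ne; have [cd _ _] := hc; have [cd' _ _] := hc'.
have cm k l : k <= l -> c l `<=` c k by exact: (chamber_mono hc).
have cm' k l : k <= l -> c' l `<=` c' k by exact: (chamber_mono hc').
case: ij => ej; rewrite {}ej in o ne.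
(* For [j = i + 1] the lattice sought is the sum of [c j] and [c' j], which share the sublattice
   [c (i + 2)]. *)
- have eA : c (i - 1) = c' (i - 1).
    apply: o; first by rewrite addrC addKr dvdN1.
    by rewrite (_ : _ - _ = -2) ?dvdN2 //; lia.
  have eB : c (i + 2) = c' (i + 2).
    apply: o; first by rewrite addrC addKr dvd2.
    by rewrite (_ : _ - _ = 1) ?dvd1 //; lia.
  have hM : hasdeg (c (i + 1)) (i + 2 - 1) by rewrite -addrA; exact: cd.
  have hM' : hasdeg (c' (i + 1)) (i + 2 - 1) by rewrite -addrA; exact: cd'.
  have [|||||N [hN N1 N2 NA Nmin]] := hasdeg_join dv pi0 nupi (cd (i - 1)) (cd (i + 2)) hM hM'.
  + by apply: cm; lia.
  + by rewrite eA; apply: cm'; lia.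
  + by apply: cm; lia.
  + by rewrite eB; apply: cm'; lia.
  + exact: ne.
  rewrite addrK in hN.
  exists N; split => //; first by rewrite -eA.
  move=> M' hM1 [s1 s2] [s3 s4]; apply/esym/(hasdeg_eq dv hM1 hN).
  by apply: Nmin => //; exact: hasdeg_omodule dv _ _ hM1.
(* For [j = i - 1] it is the intersection of [c j] and [c' j], both of colength one in
   [c (i - 2)]. *)
- have eB : c (i + 1) = c' (i + 1).
    apply: o; first by rewrite addrC addKr dvd1.
    by rewrite (_ : _ - _ = 2) ?dvd2 //; lia.
  have eA : c (i - 2) = c' (i - 2).
    apply: o; first by rewrite addrC addKr dvdN2.
    by rewrite (_ : _ - _ = -1) ?dvdN1 //; lia.
  have i21 : i - 2 + 1 = i - 1 by lia.
  have hM : hasdeg (c (i - 1)) (i - 2 + 1) by rewrite i21.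
  have hM' : hasdeg (c' (i - 1)) (i - 2 + 1) by rewrite i21.
  have := hasdeg_meet dv pi0 nupi (cd (i - 2)) (cd (i + 1)) hM hM'.
  rewrite subrK => hD.
  have {}hD : hasdeg (c (i - 1) `&` c' (i - 1)) i.
    apply: hD => //.
    + by apply: cm; lia.
    + by rewrite eA; apply: cm'; lia.
    + by apply: cm; lia.
    + by rewrite eB; apply: cm'; lia.
  exists (c (i - 1) `&` c' (i - 1)); split => //.
  + split; last by move=> x [].
    move=> x hx; split; first by move: hx; apply: cm; lia.
    by move: hx; rewrite eB; apply: cm'; lia.
  + split; last by move=> x [].
    move=> x hx; split; last by move: hx; apply: cm'; lia.
    by move: hx; rewrite -eB; apply: cm; lia.
  + move=> M' hM1 [s1 s2] [s3 s4]; apply: (hasdeg_eq dv hD hM1).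
    by move=> x Mx; split; [exact: s2|exact: s4].
Qed.

(** A gallery of type [(i, j, i)] from [x] to [z] is determined by the lattice of degree [i] shared
    by its middle chambers. It must fit into lifts of both ends, and [residue_plane] leaves exactly
    one choice. *)
Lemma Xchamber_braid x z i j : Xchamber x -> Xchamber z -> j = i + 1 \/ j = i - 1 ->
  off2 d i j x z -> ~ off1 d i x z ->
  exists y y', [/\ Xchamber y, Xchamber y',
    [/\ off1 d i x y, off1 d j y y' & off1 d i y' z] &
    forall u u', Xchamber u -> Xchamber u' -> off1 d i x u -> off1 d j u u' ->
      off1 d i u' z -> u = y /\ u' = y'].
Proof.
(* [k] is the other neighbour of [i], distinct from [i] and [j] since [d >= 3], so [x] and [z] can
   be lifted through a common vertex of type [k]. *)
move=> hx hz ij o no; pose k := if `[< j = i + 1 >] then i - 1 else i + 1.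
have ji : ~~ (d%:Z %| i - j)%Z.
  by case: ij => ->; rewrite opprD addrA subrr sub0r ?opprK ?dvdN1 ?dvd1.
have ki : ~~ (d%:Z %| k - i)%Z.
  by rewrite /k; case: asboolP => _; rewrite addrC addKr ?dvd1 ?dvdN1.
have kj : ~~ (d%:Z %| k - j)%Z.
  rewrite /k; case: asboolP => [->|]; first by rewrite (_ : _ - _ = -2) ?dvdN2 //; lia.
  by case: ij => // -> _; rewrite (_ : _ - _ = 2) ?dvd2 //; lia.
have [c [c' [hc hc' ex ez oc]]] := lift_off2 hx hz o ki kj.
have ne : c j <> c' j.
  move=> e; apply: no => l li; rewrite -ex -ez /quot.
  case: (boolP (d%:Z %| l - j)%Z) => lj; last by rewrite oc.
  by rewrite (chamber_mod pi0 hc hc' lj e).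
have [M [hM [s1 s2] [s3 s4] Muniq]] := residue_plane hc hc' ij oc ne.
have hu : chamber (upd pi c i M) by apply: (upd_chamber pi0 dv nupi d3).
have hu' : chamber (upd pi c' i M) by apply: (upd_chamber pi0 dv nupi d3).
exists (quot (upd pi c i M)), (quot (upd pi c' i M)); split.
- by exists (upd pi c i M).
- by exists (upd pi c' i M).
- split.
  + by move=> l li; rewrite -ex /quot -upd_off1.
  + move=> l lj; rewrite /quot; case: (boolP (d%:Z %| l - i)%Z) => li.
      by rewrite /upd li.
    by rewrite -!upd_off1 // oc.
  + by move=> l li; rewrite -ez /quot -upd_off1.
- move=> u u' hu1 hu1'; rewrite -ex -ez => o1 o2 o3.
  have [N [hN n1 n2 hcN eu]] := lift_off1 hc hu1 o1.
  have [N' [hN' n1' n2' hcN' eu']] := lift_off1 hc' hu1' (off1_sym o3).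
  (* [u] and [u'] have the same orbit at [i], and their lifts share the lattice at [k], so
     [lift_unique] applies. *)
  have NN' : N = N'.
    have := @lift_unique _ _ k i hcN hcN'; rewrite !upd_same; apply.
      by rewrite -!upd_off1 // oc.
    by rewrite -eu -eu'; apply: o2.
  by rewrite eu eu' -NN' (Muniq N) // NN'.
Qed.

Lemma Xchamber_connected (V : Type) (f : (int -> set (set vec)) -> V) :
  (forall i x y, Xchamber x -> Xchamber y -> off1 d i x y -> f x = f y) ->
  forall x y, Xchamber x -> Xchamber y -> f x = f y.
Proof.
move=> fP _ _ [c hc <-] [c' hc' <-].
apply: (gallery_connected pi0 dv nupi d3 (Phi := fun c => f (quot c)) _ hc hc').
move=> i c1 c2 h1 h2 o; apply: (fP i); [by exists c1|by exists c2|].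
by move=> k ki; rewrite /quot o.
Qed.

End Quotient.

Lemma In_nth (T : Type) (x0 : T) (s : seq T) (x : T) :
  List.In x s <-> exists j, (j < size s)%N /\ nth x0 s j = x.
Proof.
split.
  elim: s => //= a s IH [->|/IH[j [hj e]]]; first by exists 0%N.
  by exists j.+1.
move=> [j [+ <-]]; elim: s j => // a s IH [|j] hj; first by left.
by right; apply: IH.
Qed.

Lemma strict_desc_nth (F : fieldType) (d : nat) (t : seq (set 'cV[F]_d)) (j : nat) :
  strict_desc t -> (j.+1 < size t)%N -> nth set0 t j.+1 `<` nth set0 t j.
Proof.
elim: t j => [|a [|b t] IH] j //.
by move=> [ba st]; case: j => [|j] //= hj; apply: (IH j).
Qed.

Lemma exists_ord_mod (d : nat) (a k : int) : (0 < d)%N ->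
  exists j : 'I_d, (d%:Z %| k - (a + j%:Z))%Z.
Proof.
move=> d0; have dn0 : d%:Z != 0 by lia.
have m0 := modz_ge0 (k - a) dn0.
have hj : (`|((k - a) %% d%:Z)%Z| < d)%N by rewrite -ltz_nat gez0_abs // ltz_pmod.
exists (Ordinal hj) => /=; rewrite gez0_abs // opprD addrA.
by rewrite {1}(divz_eq (k - a) d%:Z) addrK dvdz_mull.
Qed.

Lemma ord_mod (d : nat) (i j : 'I_d) : (d%:Z %| i%:Z - j%:Z)%Z -> i = j.
Proof.
move=> h; apply/val_inj; apply/eqP; case: (ltngtP (i : nat) j) => // ij; move: h.
all: by rewrite dvdz_small //; have := ltn_ord i; have := ltn_ord j; lia.
Qed.

(** * Cells and vertices of [X] in terms of chambers *)

Section ChambersOfQuotient.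
Variables (F : fieldType) (nu : F -> int) (d : nat) (pi : F) (Gam : set 'M[F]_d).
Hypotheses (dv : discrete_valuation nu) (pi0 : pi != 0) (nupi : nu pi = 1).
Hypothesis d3 : (3 <= d)%N.
Hypotheses (GamP : PGL_subgroup Gam) (Gam_coc : cocompact nu Gam).
Hypotheses (Gam_type : type_preserving nu Gam) (Gam_inj : inj_radius_ge2 nu pi Gam).
Local Notation vec := 'cV[F]_d.
Local Notation hasdeg := (hasdeg nu).
Local Notation chamber := (chamber nu pi).
Local Notation orbit := (Defs.orbit Gam).
Local Notation quot := (quot Gam).
Local Notation Xchamber := (Xchamber nu pi Gam).
Implicit Types (c e : int -> set vec) (x y z : int -> set (set vec)) (L : set vec).

Let dpos : 0 < d%:Z. Proof. lia. Qed.
Let dn0 : d%:Z != 0. Proof. lia. Qed.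

Let int_mod_ord a k : exists j : 'I_d, (d%:Z %| k - (a + j%:Z))%Z.
Proof. by apply: exists_ord_mod; lia. Qed.

Lemma hasdeg_lat_type L n (i : 'I_d) : hasdeg L n -> (d%:Z %| n - i%:Z)%Z -> lat_type nu L i.
Proof.
move=> [g [ug -> <-]] h; exists g; split => //.
move: h; rewrite -eqz_mod_dvd => /eqP ->; rewrite modz_small //.
by rewrite ltz_nat ltn_ord.
Qed.

Lemma lat_type_hasdeg L (i : 'I_d) : lat_type nu L i ->
  exists n, hasdeg L n /\ (d%:Z %| n - i%:Z)%Z.
Proof.
move=> [g [ug -> h]]; exists (nu (\det g)); split; first by exists g.
by rewrite -eqz_mod_dvd h modz_small // ltz_nat ltn_ord.
Qed.

Lemma quot_type c c' k l : chamber c -> chamber c' -> quot c k = quot c' l -> (d%:Z %| k - l)%Z.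
Proof.
move=> [cd _ _] [cd' _ _] /(orbit_eq GamP) [g [hg e]].
have [i ki] := int_mod_ord 0 k; rewrite add0r in ki.
have := Gam_type hg (hasdeg_lattice (cd k)) (hasdeg_lat_type (cd k) ki).
rewrite -e => /lat_type_hasdeg [n [hn ni]]; rewrite (hasdeg_uniq dv hn (cd' l)) in ni.
have -> : k - l = k - i%:Z - (l - i%:Z) by lia.
exact: rpredB.
Qed.

(** A cell is a bare set of orbits, but as [Gam] preserves types each orbit determines its index
    modulo [d]. *)
Lemma range_Xchamber_inj x y : Xchamber x -> Xchamber y -> range x = range y -> x = y.
Proof.
move=> hx hy e; apply/funext => k; have [c hc cx] := hx; have [c' hc' cy] := hy.
have : range y (x k) by rewrite -e; exists k.
move=> [l _ ykl]; rewrite -ykl; apply/esym/(Xchamber_mod pi0 nupi d3 GamP hy).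
by apply: (quot_type hc hc'); rewrite cx cy.
Qed.

(** A lattice of type [i] is rescaled to degree exactly [i] and then extended to a chamber. *)
Lemma VtypeE (i : 'I_d) o : Vtype nu Gam i o <-> exists x, Xchamber x /\ x i%:Z = o.
Proof.
split.
  move=> [L [_ /lat_type_hasdeg[n [hn /dvdzP[m e]]]] <-].
  have := hasdeg_scale dv (expfz_neq0 (- m) pi0) hn; rewrite nu_exprz // nupi mulr1.
  rewrite (_ : n + _ = i%:Z); last lia.
  move=> /(exists_chamber pi0 dv nupi d3) [c [hc ci]]; exists (quot c); split; first by exists c.
  by rewrite /quot ci (orbit_scale GamP) // expfz_neq0.
move=> [_ [[c hc <-] <-]]; have [cd _ _] := hc; exists (c i%:Z) => //.
split; first exact: hasdeg_lattice (cd _).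
by apply: (hasdeg_lat_type (cd _)); rewrite subrr dvdz0.
Qed.

Lemma chamber_Xtop c : chamber c -> Xtop nu pi Gam (range (quot c)).
Proof.
move=> hc; have iE : map Posz (iota 0 d) = 0%:Z :: map Posz (iota 1 d.-1).
  by rewrite -[X in iota 0 X](@prednK d) //; lia.
exists [seq c l | l <- map Posz (iota 0 d)]; last first.
  apply/seteqP; split.
    move=> _ [L /(In_nth set0)[j [hj <-]] <-]; move: hj; rewrite !size_map size_iota => hj.
    by rewrite (nth_map 0) ?size_map ?size_iota //; exists (nth 0 (map Posz (iota 0 d)) j).
  move=> _ [k _ <-]; have [j kj] := int_mod_ord 0 k; rewrite add0r in kj.
  rewrite (quot_mod pi0 nupi d3 GamP hc kj); exists (c j%:Z) => //.
  apply/(In_nth set0); exists j; rewrite !size_map size_iota; split => //.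
  by rewrite (nth_map 0) ?size_map ?size_iota // (nth_map 0%N) ?size_iota // nth_iota.
split; last by rewrite !size_map size_iota.
rewrite iE; apply: (chamber_face dv pi0 nupi d3 hc).
  rewrite path_map (eq_path (e' := ltn)); last by move=> a b /=; rewrite ltz_nat.
  exact: (iota_ltn_sorted 0 d.-1.+1).
rewrite last_map (last_nth 0%N) size_iota.
rewrite (_ : 0%N :: iota 1 d.-1 = iota 0 d.-1.+1) // nth_iota // add0n add0r ltz_nat; lia.
Qed.

(** The degrees in a face chain of size [d] increase strictly and stay within less than [d] of the
    first, so they are consecutive; the chain is then a flag that extends periodically. *)
Lemma Xtop_chamber s : is_face nu pi s -> size s = d ->
  exists c, chamber c /\ [set orbit L | L in [set L | List.In L s]] = range (quot c).
Proof.
move=> [latS _ [t [szt fct ts st]]] szs; rewrite szs in szt.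
have svorb L L' : same_vertex L L' -> orbit L' = orbit L.
  by move=> [a [a0 ->]]; apply: orbit_scale.
have tdeg j : exists n, (j < d)%N -> hasdeg (nth set0 t j) n.
  case: (ltnP j d) => jd; last by exists 0.
  have [|L [Ls [a [a0 e]]]] := ts (nth set0 t j).
    by apply/(In_nth set0); exists j; rewrite szt.
  have /is_lattice_hasdeg[n hn] := latS _ Ls.
  by exists (n + d%:Z * nu a) => _; rewrite e; apply: hasdeg_scale.
have [n hn] := choice tdeg.
have [sd last_pi] : strict_desc t /\ scale_set pi (nth set0 t 0) `<` nth set0 t d.-1.
  move: fct; case: (t) szt => //= L1 t' szt [sd lp]; split => //.
  by move: lp; rewrite (last_nth set0) (_ : d.-1 = size t') //; lia.
have nS j : (j.+1 < d)%N -> n j < n j.+1.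
  move=> jd; have [|s1 s2] := strict_desc_nth sd (j := j); first by rewrite szt.
  by apply: (hasdeg_lt dv (hn j _) (hn j.+1 _)) => //; exact: ltnW.
have nlast : n d.-1 < n 0%N + d%:Z.
  have [s1 s2] := last_pi; have h0 := hn 0%N ltac:(lia).
  have := hasdeg_scale dv pi0 h0; rewrite nupi mulr1 => h1.
  by apply: (hasdeg_lt dv (hn d.-1 _) h1) => //; lia.
have nlow j : (j < d)%N -> n 0%N + j%:Z <= n j.
  elim: j => [|j IH] jd; first by rewrite addr0.
  by have := nS j jd; have := IH (ltnW jd); lia.
have nup r : (r < d)%N -> n (d.-1 - r)%N + r%:Z <= n d.-1.
  elim: r => [|r IH] rd; first by rewrite addr0 subn0.
  have := nS (d.-1 - r.+1)%N ltac:(lia); have := IH (ltnW rd).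
  by rewrite (_ : (d.-1 - r.+1).+1 = d.-1 - r)%N; lia.
have nE j : (j < d)%N -> n j = n 0%N + j%:Z.
  move=> jd; have := nlow j jd; have := nup (d.-1 - j)%N ltac:(lia).
  by rewrite subKn; lia.
have [|||c [hc ct]] := @exists_chamber_flag _ _ _ _ pi0 dv nupi d3 (n 0%N) (nth set0 t).
- by move=> j jd; rewrite -nE //; exact: hn.
- by move=> j jd; have [|] := strict_desc_nth sd (j := j); rewrite ?szt.
- by case: last_pi.
exists c; split => //; apply/seteqP; split.
  move=> _ [L /st[L' [/(In_nth set0)[j [jd <-]] sv]] <-]; rewrite szt in jd.
  by exists (n 0%N + j%:Z) => //; rewrite /quot ct // (svorb _ _ sv).
move=> _ [k _ <-]; have [j kj] := int_mod_ord (n 0%N) k.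
rewrite (quot_mod pi0 nupi d3 GamP hc kj) /quot ct //.
have [|L [Ls sv]] := ts (nth set0 t j).
  by apply/(In_nth set0); exists j; rewrite szt.
by exists L => //; rewrite (svorb _ _ sv).
Qed.

Lemma XtopE : Xtop nu pi Gam = [set range x | x in Xchamber].
Proof.
apply/seteqP; split.
  move=> _ [s [fs szs] <-]; have [c [hc ->]] := Xtop_chamber fs szs.
  by exists (quot c) => //; exists c.
by move=> _ [_ [c hc <-] <-]; exact: chamber_Xtop.
Qed.

Lemma Xchamber_range_type x (i : 'I_d) o : Xchamber x -> range x o -> Vtype nu Gam i o ->
  x i%:Z = o.
Proof.
move=> hx [k _ <-] /VtypeE[y [hy e]]; have [c hc cx] := hx; have [c' hc' cy] := hy.
apply/esym/(Xchamber_mod pi0 nupi d3 GamP hx); apply: (quot_type hc hc').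
by rewrite cx cy.
Qed.

(** As [W i] contains vertices of type [i] only, and a chamber has one such vertex, meeting [W i]
    exactly once means that this vertex lies in it. *)
Lemma EcellsE (W : 'I_d -> set (set (set vec))) : (forall i, W i `<=` Vtype nu Gam i) ->
  Ecells nu pi Gam W = [set range x | x in [set x | Xchamber x /\ forall i, W i (x i%:Z)]].
Proof.
move=> WV; rewrite /Ecells XtopE; apply/seteqP; split.
  move=> _ [[x hx <-] hW]; exists x => //; split => // i.
  have [o [[ro Wo] _]] := hW i.
  by rewrite (Xchamber_range_type hx ro (WV _ _ Wo)).
move=> _ [x [hx hW] <-]; split; first by exists x.
move=> i; exists (x i%:Z); split; first by split => //; exists i%:Z.
by move=> o [ro Wo]; apply: Xchamber_range_type => //; exact: WV.
Qed.

(** A chamber of [X] is determined by its values on one period, each the orbit of one of finitely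
    many lattices. *)
Lemma Xchamber_finite : finite_set Xchamber.
Proof.
have [s hs] := Gam_coc.
pose g (f : {ffun 'I_d.-1.+1 -> 'I_(size s).+1}) (k : int) :=
  orbit (nth set0 s (f (inord `|(k %% d%:Z)%Z|))).
apply: (sub_finite_set (B := range g)); last exact: finite_image.
move=> x hx; have [c hc cx] := hx; have [cd _ _] := hc.
have orbs k : exists j, (j < size s)%N /\ x k = orbit (nth set0 s j).
  have [L0 [/(In_nth set0)[j [hj <-]] _ [h [hh e]]]] := hs (c k) (hasdeg_lattice (cd k)).
  by exists j; rewrite -cx /quot e orbit_act.
have [f hf] := choice orbs.
exists [ffun j : 'I_d.-1.+1 => inord (f (j : nat)%:Z)] => //.
apply/funext => k; rewrite /g ffunE.
have m0 := modz_ge0 k dn0; have ml := ltz_pmod k dpos.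
have e : (inord `|(k %% d%:Z)%Z| : 'I_d.-1.+1)%:Z = (k %% d%:Z)%Z.
  rewrite inordK; first by rewrite gez0_abs.
  by move: m0 ml; move: (k %% d%:Z)%Z => r; lia.
rewrite e inordK; last by rewrite ltnW // ltnS; case: (hf (k %% d%:Z)%Z).
have [_ <-] := hf (k %% d%:Z)%Z; apply: (Xchamber_mod pi0 nupi d3 GamP hx).
by rewrite {2}(divz_eq k d%:Z) opprD addrCA subrr addr0 rpredN dvdz_mull.
Qed.

Lemma exists_Xchamber : exists x, Xchamber x.
Proof.
have [L hL] := std_exists d dv.
by have [c [hc _]] := exists_chamber pi0 dv nupi d3 hL; exists (quot c), c.
Qed.

(* [GL_d(F)] acts transitively on the vertices of a given type, so they all lie
   in the same number of chambers. *)
Lemma Xchamber_transport (i : 'I_d) o o' : Vtype nu Gam i o -> Vtype nu Gam i o' ->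
  exists phi : (int -> set (set vec)) -> int -> set (set vec),
    (forall x, Xchamber x -> x i%:Z = o -> Xchamber (phi x) /\ phi x i%:Z = o') /\
    (forall x y, Xchamber x -> x i%:Z = o -> Xchamber y -> y i%:Z = o -> phi x = phi y -> x = y).
Proof.
move=> /VtypeE[_ [[c hc <-] ci]] /VtypeE[_ [[c' hc' <-] ci']].
have [cd _ _] := hc; have [cd' _ _] := hc'.
have [g [ug [g0 gL]]] : exists g, g \in unitmx /\ nu (\det g) = 0 /\ act g (c i%:Z) = c' i%:Z.
  (* Both lattices have degree [i], so the base change between them has determinant of valuation
     zero. *)
  have [h [uh hE dh]] := cd i%:Z; have [h' [uh' hE' dh']] := cd' i%:Z.
  exists (h' *m invmx h); split; first by rewrite unitmx_mul uh' unitmx_inv.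
  split; last first.
    rewrite hE hE' /act /lattice_of image_comp; congr image.
    by apply/funext => v /=; rewrite mulmxA mulmxKV.
  rewrite det_mulmx det_inv nuM ?invr_eq0 ?(unit_det uh) ?(unit_det uh') //.
  by rewrite nuV ?(unit_det uh) // dh dh' subrr.
have lift x : exists e, Xchamber x -> x i%:Z = o ->
    [/\ chamber e, quot e = x & e i%:Z = c i%:Z].
  case: (pselect (Xchamber x /\ x i%:Z = o)) => [[hx xo]|n]; last by exists c => hx xo; case: n.
  have [|e [he ex ec]] := lift_agree dv pi0 nupi d3 GamP Gam_inj hc hx (k := i%:Z).
    by rewrite xo ci.
  by exists e => _ _; split => //; apply: ec; rewrite xo ci.
have [l hl] := choice lift.
(* [g] need not normalise [Gam], so it acts not on [X] but on the lifts through the chosen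
   vertex. *)
pose ph x k := act g (l x k).
have phP x : Xchamber x -> x i%:Z = o -> chamber (ph x) /\ ph x i%:Z = c' i%:Z.
  move=> hx xo; have [he ex ei] := hl x hx xo.
  by split; [exact: (act_chamber dv he ug g0) | rewrite /ph ei].
exists (fun x => quot (ph x)); split.
  move=> x hx xo; have [h1 h2] := phP x hx xo; split; first by exists (ph x).
  by rewrite /quot h2.
move=> x y hx xo hy yo e; have [h1 h2] := phP x hx xo; have [h1' h2'] := phP y hy yo.
have ee : ph x = ph y.
  apply/funext => k; apply: (lift_unique dv pi0 nupi d3 GamP Gam_inj h1 h1' (k := i%:Z)).
    by rewrite h2 h2'.
  by rewrite e.
have [_ <- _] := hl x hx xo; have [_ <- _] := hl y hy yo; congr quot.
apply/funext => k; rewrite -(actK (l x k) ug) -(actK (l y k) ug); congr act.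
exact: (congr1 (fun f => f k) ee).
Qed.

End ChambersOfQuotient.

(** * Counting in the quotient *)

Lemma sum_nat_unique (T : finType) (P : pred T) (y0 : T) :
  P y0 -> (forall y, P y -> y = y0) -> (\sum_y P y = 1)%N.
Proof.
move=> P0 uniqP; rewrite (bigD1 y0) //= P0 big1 ?addn0 // => y /eqP ne.
by case Py: (P y) => //; case: ne; apply: uniqP.
Qed.

Lemma card_fsub_seq (K : choiceType) (A : {fset K}) (P : pred A) (l : seq K) :
  uniq l -> (forall k, k \in l <-> exists a : A, P a /\ val a = k) -> #|P| = size l.
Proof.
move=> ul hl; rewrite cardE -(size_map val); apply/perm_size/uniq_perm => //.
  by rewrite map_inj_uniq ?enum_uniq //; exact: val_inj.
move=> k; apply/idP/idP.
  by move=> /mapP[a]; rewrite mem_enum => Pa ->; apply/hl; exists a.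
by move=> /hl[a [Pa <-]]; rewrite map_f // mem_enum.
Qed.

Lemma card_fset_set_image (K K' : choiceType) (A : set K) (f : K -> K') :
  finite_set A -> {in A &, injective f} -> #|` fset_set (f @` A)| = #|` fset_set A|.
Proof.
move=> fA finj; rewrite fset_set_image // card_in_imfset //= => x y.
by rewrite !in_fset_set // => /finj h /h.
Qed.

Lemma card_fset_set_pred (K : choiceType) (A : set K) (P : set K) : finite_set A ->
  #|` fset_set (A `&` P)| = #|[pred x : fset_set A | `[< P (val x) >]]|.
Proof.
move=> fA; apply/esym/card_fsub_seq; first exact: fset_uniq.
move=> k; have fAP : finite_set (A `&` P) by apply: finite_setIl.
rewrite in_fset_set // inE; split.
  move=> [Ak Pk]; have kA : k \in fset_set A by rewrite in_fset_set // inE.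
  by exists [` kA]%fset; split => //; apply/asboolP.
move=> [a [/asboolP Pa <-]]; split => //.
by have := fsvalP a; rewrite in_fset_set // inE.
Qed.

(** * The chamber system of [X] and the mixing bound *)

Section MainTheorem.
Variables (R : realType) (F : fieldType) (nu : F -> int) (q d : nat) (pi : F).
Variable Gam : set 'M[F]_d.
Hypotheses (dv : discrete_valuation nu) (pi0 : pi != 0) (nupi : nu pi = 1).
Hypotheses (hq : residue_field_card nu q) (q0 : (0 < q)%N) (d3 : (3 <= d)%N).
Hypotheses (GamP : PGL_subgroup Gam) (Gam_coc : cocompact nu Gam).
Hypotheses (Gam_type : type_preserving nu Gam) (Gam_inj : inj_radius_ge2 nu pi Gam).
Local Notation vec := 'cV[F]_d.
Local Notation Xchamber := (Xchamber nu pi Gam).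

Let finX : finite_set Xchamber.
Proof. exact: (Xchamber_finite pi0 nupi d3 GamP Gam_coc). Qed.

Local Notation T := (fset_set Xchamber).

Let Tval (x : T) : Xchamber (val x).
Proof. by have := fsvalP x; rewrite in_fset_set // inE. Qed.

Let toT y : Xchamber y -> exists x : T, val x = y.
Proof.
move=> hy; have h : y \in fset_set Xchamber by rewrite in_fset_set // inE.
by exists [` h]%fset.
Qed.

Definition Xadj (i : 'I_d) : rel T := fun x y => `[< off1 d i%:Z (val x) (val y) >].
(** Adjacency in the affine diagram of type A, a cycle of length [d]. *)
Definition Xnb (i j : 'I_d) :=
  (d%:Z %| j%:Z - (i%:Z + 1))%Z || (d%:Z %| j%:Z - (i%:Z - 1))%Z.

Let ord_ndvd (i j : 'I_d) : i != j -> ~~ (d%:Z %| i%:Z - j%:Z)%Z.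
Proof. by apply: contraNN => /ord_mod ->. Qed.

Lemma Xadj_refl i : reflexive (Xadj i).
Proof. by move=> x; apply/asboolP. Qed.

Lemma Xadj_sym i : symmetric (Xadj i).
Proof. by move=> x y; apply/asboolP/asboolP; exact: off1_sym. Qed.

Lemma Xadj_trans i : transitive (Xadj i).
Proof. by move=> y x z /asboolP h /asboolP h'; apply/asboolP; exact: off1_trans h'. Qed.

Lemma Xadj_card i x : #|[pred y | Xadj i x y]| = q.+1.
Proof.
have [l [ul <- ml]] :=
  Xchamber_class_card dv pi0 nupi d3 GamP Gam_inj i%:Z hq (Tval x).
apply: card_fsub_seq => // k; split.
  move=> /ml[/toT[y <-] o]; exists y; split => //; exact/asboolP.
by move=> [y [/asboolP o <-]]; apply/ml.
Qed.

Let Xadj_eq i j x y : i != j -> Xadj i x y -> Xadj j x y -> x = y.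
Proof.
move=> ij /asboolP oi /asboolP oj; apply: val_inj.
exact: (off1_eq (ord_ndvd ij) oi oj).
Qed.

(** Existence is [Xchamber_commute]. Two middle chambers would be both [i]-adjacent and
    [j]-adjacent, hence equal. The right side is symmetric in [i] and [j], which gives
    commutation. *)
Let two_step i j x z : i != j -> ~~ Xnb i j ->
  (\sum_y (Xadj i x y && Xadj j y z))%N = `[< off2 d i%:Z j%:Z (val x) (val z) >].
Proof.
move=> ij; rewrite negb_or => /andP[n1 n2]; case: asboolP => o.
  have ji : ~~ (d%:Z %| j%:Z - i%:Z)%Z by apply: ord_ndvd; rewrite eq_sym.
  have [||y [/toT[u <-] o1 o2]] := Xchamber_commute dv pi0 nupi d3 GamP Gam_inj
    (Tval x) (Tval z) o ji.
  - by move: n1; rewrite opprD addrA.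
  - by move: n2; rewrite opprB addrA addrAC.
  rewrite (sum_nat_unique (y0 := u)) //.
    by apply/andP; split; apply/asboolP.
  move=> v /andP[xv vz]; apply: (Xadj_eq ij).
    by apply: Xadj_trans (_ : Xadj i v x) _; [rewrite Xadj_sym | apply/asboolP].
  by apply: Xadj_trans vz _; rewrite Xadj_sym; apply/asboolP.
rewrite big1 // => y _; case: andP => // -[/asboolP o1 /asboolP o2].
by case: o => k ki kj; rewrite o1 // o2.
Qed.

Lemma Xnb_sym i j : Xnb i j = Xnb j i.
Proof.
rewrite /Xnb orbC; congr (_ || _).
  by rewrite -rpredN (_ : - (j%:Z - (i%:Z - 1)) = i%:Z - (j%:Z + 1)) //; lia.
by rewrite -rpredN (_ : - (j%:Z - (i%:Z + 1)) = i%:Z - (j%:Z - 1)) //; lia.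
Qed.

Let off2_asboolC i j (x z : T) : `[< off2 d i%:Z j%:Z (val x) (val z) >] =
  `[< off2 d j%:Z i%:Z (val x) (val z) >].
Proof. by apply/asboolP/asboolP; exact: off2C. Qed.

Lemma Xadj_comm i j : i != j -> ~~ Xnb i j -> forall x z,
  (\sum_y (Xadj i x y && Xadj j y z) = \sum_y (Xadj j x y && Xadj i y z))%N.
Proof.
move=> ij nij x z; rewrite two_step // two_step ?[j == i]eq_sym // 1?Xnb_sym //.
by rewrite off2_asboolC.
Qed.

(** If [z] is [i]-adjacent to [x], the second chamber is any of the [q + 1] in the class and the
    third must equal it. Otherwise the gallery exists exactly within the residue, and is unique by
    [Xchamber_braid]. *)
Lemma Xgalleries i j x z : i != j -> Xnb i j ->
  galleries Xadj i j x z = (q * Xadj i x z + `[< off2 d i%:Z j%:Z (val x) (val z) >])%N.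
Proof.
move=> ij nij; rewrite /galleries; case xz: (Xadj i x z).
  have -> : `[< off2 d i%:Z j%:Z (val x) (val z) >] = true.
    by apply/asboolP/off1_off2/asboolP.
  rewrite muln1 addn1 -(Xadj_card i x) -sum1_card [RHS]big_mkcond /=.
  apply: eq_bigr => y _; rewrite inE; case xy: (Xadj i x y) => /=; last by rewrite big1.
  rewrite (sum_nat_unique (y0 := y)) //.
    by rewrite Xadj_refl (Xadj_trans _ xz) // Xadj_sym.
  move=> u /andP[yu uz]; apply/esym/(Xadj_eq ij) => //.
  apply: Xadj_trans (_ : Xadj i x u); first by rewrite Xadj_sym.
  by apply: Xadj_trans xz _; rewrite Xadj_sym.
rewrite muln0 add0n; case: asboolP => o; last first.
  rewrite big1 // => y _; rewrite big1 // => u _.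
  case: and3P => // -[/asboolP h1 /asboolP h2 /asboolP h3].
  by case: o; exact: off2_gallery h1 h2 h3.
have no : ~ off1 d i%:Z (val x) (val z) by move=> h; move/asboolP: xz; apply.
have [j' [jj' dj]] : exists j', (j' = i%:Z + 1 \/ j' = i%:Z - 1) /\ (d%:Z %| j%:Z - j')%Z.
  by case/orP: nij => h; [exists (i%:Z + 1)|exists (i%:Z - 1)]; split => //; [left|right].
have jd : (d%:Z %| j' - j%:Z)%Z by rewrite -opprB rpredN.
have [y [u [/toT[y1 ey] /toT[u1 eu] [o1 o2 o3] unq]]] := Xchamber_braid dv pi0 nupi d3 GamP
  Gam_inj (Tval x) (Tval z) jj' (off2_mod dj o) no.
have yP : forall y2 : T, (\sum_u [&& Xadj i x y2, Xadj j y2 u & Xadj i u z] = (y2 == y1))%N.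
  move=> y2; case: eqP => [->|ne].
    apply: (sum_nat_unique (y0 := u1)).
      apply/and3P; split; apply/asboolP; rewrite ?ey ?eu //; exact: off1_mod jd o2.
    move=> u2 /and3P[/asboolP h1 /asboolP h2 /asboolP h3]; apply: val_inj.
    by have [_ ->] := unq _ _ (Tval y1) (Tval u2) h1 (off1_mod dj h2) h3.
  rewrite big1 // => u2 _; case: and3P => // -[/asboolP h1 /asboolP h2 /asboolP h3].
  case: ne; apply: val_inj.
  by have [-> _] := unq _ _ (Tval y2) (Tval u2) h1 (off1_mod dj h2) h3.
under eq_bigr => y2 _ do rewrite yP.
by apply: (sum_nat_unique (P := fun y2 => y2 == y1) (y0 := y1)) => // y2 /eqP.
Qed.

Lemma Xadj_braid i j : i != j -> Xnb i j -> forall x z,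
  (galleries Xadj i j x z + q * Xadj j x z = galleries Xadj j i x z + q * Xadj i x z)%N.
Proof.
move=> ij nij x z; rewrite !Xgalleries 1?[j == i]eq_sym // 1?Xnb_sym //.
by rewrite off2_asboolC addnAC [RHS]addnAC; congr (_ + _)%N; exact: addnC.
Qed.

Lemma Xadj_connected (f : T -> R) : (forall i x y, Xadj i x y -> f x = f y) ->
  forall x y, f x = f y.
Proof.
(* [g] extends [f] by zero to all sequences of orbits, on which [Xchamber_connected] is stated. *)
move=> fP x y; pose g u := if pselect (exists t : T, val t = u) is left h
  then f (projT1 (cid h)) else 0.
have gE t : g (val t) = f t.
  rewrite /g; case: pselect => [h|[]]; last by exists t.
  by case: cid => /= s /val_inj ->.
rewrite -!gE; apply: (Xchamber_connected dv pi0 nupi d3 (Gam := Gam) _ (Tval x) (Tval y)).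
move=> i _ _ /toT[u <-] /toT[v <-] o; rewrite !gE.
have [i' ii'] := exists_ord_mod 0 i (ltnW (ltnW d3)); rewrite add0r in ii'.
by apply: (fP i'); apply/asboolP; exact: off1_mod ii' o.
Qed.

Lemma Xnb_le2 i : (\sum_j Xnb i j <= 2)%N.
Proof.
have le1 (a : int) : (\sum_(j < d) (d%:Z %| (j%:Z - a)%R)%Z <= 1)%N.
  case: (pickP (fun j : 'I_d => (d%:Z %| j%:Z - a)%Z)) => [j0 h0|h]; last first.
    by rewrite big1 // => j _; rewrite (h j).
  rewrite (sum_nat_unique (y0 := j0)) // => j h.
  apply: ord_mod; have -> : j%:Z - j0%:Z = j%:Z - a - (j0%:Z - a) by lia.
  exact: rpredB.
apply: (@leq_trans (\sum_(j < d) ((d%:Z %| (j%:Z - (i%:Z + 1))%R)%Z + (d%:Z %| (j%:Z - (i%:Z - 1))%R)%Z))).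
  by apply: leq_sum => j _; rewrite /Xnb; case: (_ \in _); case: (_ \in _).
by rewrite big_split /= (leq_add (le1 _) (le1 _)).
Qed.

Let n0 : (0 < #|{: T}|)%N.
Proof.
have [x /toT[t _]] := exists_Xchamber Gam dv pi0 nupi d3.
by apply/card_gt0P; exists t.
Qed.

Let finV i : finite_set (Vtype nu Gam i).
Proof.
rewrite (_ : Vtype nu Gam i = [set x i%:Z | x in Xchamber]); first exact: finite_image.
apply/seteqP; split=> o.
  by move/(VtypeE dv pi0 nupi d3 GamP) => [x [hx <-]]; exists x.
by move=> [x hx <-]; apply/(VtypeE dv pi0 nupi d3 GamP); exists x.
Qed.

(** The transport injects the chambers through [o] into those through [o']; on these the default
    value of [insubd] is never taken. *)
Let count_le i o o' : Vtype nu Gam i o -> Vtype nu Gam i o' ->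
  (#|[pred x : T | val x i%:Z == o]| <= #|[pred x : T | val x i%:Z == o']|)%N.
Proof.
move=> ho ho'.
have [phi [phiP phiI]] := Xchamber_transport dv pi0 nupi d3 GamP Gam_inj ho ho'.
pose f (x : T) : T := insubd x (phi (val x)).
have fE x : val x i%:Z = o -> val (f x) = phi (val x).
  move=> xo; have [h _] := phiP _ (Tval x) xo.
  by rewrite /f val_insubd in_fset_set // mem_set.
rewrite -(card_in_imset (f := f)); last first.
  move=> x y /= xo yo e; apply: val_inj.
  have {}xo : val x i%:Z = o by apply/eqP.
  have {}yo : val y i%:Z = o by apply/eqP.
  have h : phi (val x) = phi (val y) by rewrite -(fE _ xo) -(fE _ yo) e.
  exact (phiI _ _ (Tval x) xo (Tval y) yo h).
apply: subset_leq_card; apply/fintype.subsetP => _ /imsetP[x xo ->].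
have {}xo : val x i%:Z = o by apply/eqP.
by apply/eqP; rewrite (fE _ xo); have [_ ->] := phiP _ (Tval x) xo.
Qed.

(** Each vertex of type [i] lies in the same number [D] of chambers, so counting chambers by their
    vertex of type [i] gives [D |W|] of them over [W]. *)
Lemma marginal i (W : set (set (set vec))) : W `<=` Vtype nu Gam i ->
  #|[pred x : T | `[< W (val x i%:Z) >]]|%:R / #|{: T}|%:R =
  #|` fset_set W|%:R / #|` fset_set (Vtype nu Gam i)|%:R :> R.
Proof.
move=> WV; have [x0 /toT[t0 _]] := exists_Xchamber Gam dv pi0 nupi d3.
have typ (x : T) : Vtype nu Gam i (val x i%:Z).
  by apply/(VtypeE dv pi0 nupi d3 GamP); exists (val x).
pose D := #|[pred x : T | val x i%:Z == val t0 i%:Z]|.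
have DE o : Vtype nu Gam i o -> #|[pred x : T | val x i%:Z == o]| = D.
  by move=> ho; apply/eqP; rewrite eqn_leq !count_le.
have cnt (U : set (set (set vec))) : U `<=` Vtype nu Gam i ->
    #|[pred x : T | `[< U (val x i%:Z) >]]| = (#|` fset_set U| * D)%N.
  move=> UV; have fU : finite_set U by apply: sub_finite_set (finV i).
  rewrite -sum1_card.
  have -> : (\sum_(x : T | x \in [pred x : T | `[< U (val x i%:Z) >]]) 1)%N =
     (\sum_(o <- fset_set U | o \in fset_set U) \sum_(x : T | val x i%:Z == o) 1)%N.
    rewrite (exchange_big_dep (fun x : T => `[< U (val x i%:Z) >])) /=.
      apply: eq_bigr => x; rewrite inE => /asboolP Ux.
      have Ux' : val x i%:Z \in fset_set U by rewrite in_fset_set // inE.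
      rewrite (big_rem (val x i%:Z)) //= Ux' eqxx big_seq_cond big1 ?addn0 //.
      move=> o /and3P[+ _ /eqP e].
      by rewrite mem_rem_uniq ?fset_uniq // inE e eqxx.
    by move=> o x; rewrite in_fset_set // inE => Uo /eqP ->; apply/asboolP.
  rewrite (eq_bigr (fun=> D)) ?big_const_seq.
    rewrite iter_addn_0 mulnC; congr muln.
    by rewrite (eq_in_count (a2 := predT)) ?count_predT // => o ->.
  move=> o; rewrite in_fset_set // inE => /UV /DE <-.
  by rewrite -sum1_card; apply: eq_bigl => x; rewrite inE.
have D0 : D%:R != 0 :> R.
  by rewrite pnatr_eq0 -lt0n; apply/card_gt0P; exists t0; rewrite inE.
(* The same count for all vertices of type [i] gives the total number of chambers, and [D]
   cancels. *)
have nE : #|{: T}| = (#|` fset_set (Vtype nu Gam i)| * D)%N.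
  rewrite -cnt //; apply: eq_card => x; rewrite !inE.
  by apply/esym/asboolP/typ.
rewrite cnt // nE !natrM -mulf_div divff ?mulr1 //.
Qed.

(** Cells are identified with chambers, and [marginal] turns each density [|W_i| / |V_i|] into the
    proportion of chambers whose vertex of type [i] lies in [W i]; this is the setting of
    [chamber_mixing]. *)
Lemma mixing (W : 'I_d -> set (set (set vec))) : (forall i, W i `<=` Vtype nu Gam i) ->
  `| (#|` fset_set (Ecells nu pi Gam W)|%:R / #|` fset_set (Xtop nu pi Gam)|%:R : R)
     - \prod_(i < d) (#|` fset_set (W i)|%:R / #|` fset_set (Vtype nu Gam i)|%:R) |
  <= 2 * d%:R / Num.sqrt (q%:R).
Proof.
move=> WV; pose P (i : 'I_d) : pred T := fun x => `[< W i (val x i%:Z) >].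
have rinj : {in Xchamber &, injective (fun x : int -> set (set vec) => range x)}.
  move=> x y; rewrite !inE => hx hy.
  exact: (range_Xchamber_inj dv pi0 nupi d3 GamP Gam_type).
have XtE : #|` fset_set (Xtop nu pi Gam)| = #|{: T}|.
  by rewrite (XtopE dv pi0 nupi d3 GamP) card_fset_set_image // cardfE.
have EcE : #|` fset_set (Ecells nu pi Gam W)| = #|[pred x | [forall i, P i x]]|.
  rewrite (EcellsE dv pi0 nupi d3 GamP Gam_type WV) card_fset_set_image.
  - rewrite (card_fset_set_pred (fun x => forall i, W i (x i%:Z)) finX).
    apply: eq_card => x; rewrite !inE; apply/asboolP/forallP => h i; first exact/asboolP.
    by have /asboolP := h i.
  - by apply: sub_finite_set finX => x [].
  - by move=> x y; rewrite !inE => -[hx _] [hy _]; apply: rinj; rewrite inE.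
rewrite XtE EcE.
rewrite (eq_bigr (fun i => #|P i|%:R / #|{: T}|%:R)); last first.
  by move=> i _; rewrite -marginal.
apply: (@chamber_mixing R T d q Xadj Xnb) => //.
- exact: Xadj_sym.
- exact: Xadj_trans.
- exact: Xadj_card.
- exact: Xadj_comm.
- exact: Xadj_braid.
- exact: Xadj_connected.
- exact: Xnb_le2.
move=> i j x y ji /asboolP o; rewrite /P o //.
by apply: ord_ndvd; rewrite eq_sym.
Qed.

End MainTheorem.

Unset Implicit Arguments.
Set Strict Implicit.

Theorem theorem1p3 (R : realType) (F : fieldType) (nu : F -> int) (q : nat)
  (pi : F) (d : nat) (Gam : set 'M[F]_d)
  (W : 'I_d -> set (set (set 'cV[F]_d))) :
  local_field nu q -> pi != 0 -> nu pi = 1 -> odd q -> (3 <= d)%N ->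
  cocompact_lattice nu Gam -> type_preserving nu Gam ->
  inj_radius_ge2 nu pi Gam ->
  (forall i, W i `<=` Vtype nu Gam i) ->
  `| (#|` fset_set (Ecells nu pi Gam W)|%:R / #|` fset_set (Xtop nu pi Gam)|%:R : R)
     - \prod_(i < d) (#|` fset_set (W i)|%:R / #|` fset_set (Vtype nu Gam i)|%:R) |
  <= 2 * d%:R / Num.sqrt (q%:R).
Proof.
move=> [dv _ hq] pi0 nupi oq d3 [GamP _ Gam_coc] Gam_type Gam_inj WV.
exact: mixing dv pi0 nupi hq (odd_gt0 oq) d3 GamP Gam_coc Gam_type Gam_inj _ WV.
Qed.
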